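(* Let $n>1$, let $U\subset\mathbb{R}^n\setminus\{0\}$ be a nonempty $O(n)$-invariant open set, set $I=\{|x|:x\in U\}$, and let $f\colon I\to(0,+\infty)$ be a $C^2$ function. Let $\Sigma=\{x+iy\in\mathbb{C}^n: x\in U,\ |y|=f(|x|)\}$. In the formulas below, $f,f',f''$ are evaluated at $|x|$. (1) The domain $D_-=\{x+iy\in\mathbb{C}^n: x\in U,\ |y|<f(|x|)\}$ is strongly pseudoconvex along $\Sigma$ if and only if, for all $x\in U$, $$\frac{ff'}{|x|}<1,\qquad f\cdot\left(f''+\frac{f'^3}{|x|}\right)<1.$$ (2) The domain $D_+=\{x+iy\in\mathbb{C}^n: x\in U,\ |y|>f(|x|)\}$ is strongly pseudoconvex along $\Sigma$ when the reverse inequalities hold, i.e. when for all $x\in U$, $$\frac{ff'}{|x|}>1,\qquad f\cdot\left(f''+\frac{f'^3}{|x|}\right)>1.$$ (3) Suppose $f$ satisfies the differential equation $f\cdot\left(f''+\frac{f'^3}{|x|}\right)=1$ for all $x\in U$. If $ff'/|x|<1$ for all $x\in U$, then $D_-$ is weakly pseudoconvex along $\Sigma$; if $ff'/|x|>1$ for all $x\in U$, then $D_+$ is weakly pseudoconvex along $\Sigma$.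
   Context: Coordinates on $\mathbb{C}^n$ are $z=x+iy$ with $x,y\in\mathbb{R}^n$; $|x|$, $|y|$ are Euclidean norms. A set $U\subset\mathbb{R}^n$ is $O(n)$-invariant if $x\in U$ and $|x'|=|x|$ imply $x'\in U$. For a real $C^2$ function $\rho$, the Levi form is $\mathcal{L}_\rho(z;v)=\sum_{j,k=1}^n\frac{\partial^2\rho}{\partial z_j\partial\bar z_k}(z)\,v_j\bar v_k$. If a domain $D$ is given near a real hypersurface $\Sigma$ as $\{\rho<0\}$, with $\rho$ of class $C^2$, $\Sigma=\{\rho=0\}$ and $d\rho\neq0$ on $\Sigma$, then $D$ is called strongly (resp. weakly) pseudoconvex along $\Sigma$ if $\mathcal{L}_\rho(p;v)>0$ (resp. $\geq0$) for every $p\in\Sigma$ and every nonzero $v$ in the complex tangent space $T_p^{\mathbb{C}}\Sigma=\{v\in\mathbb{C}^n:\sum_{k=1}^n\frac{\partial\rho}{\partial z_k}(p)v_k=0\}$. *)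

(* Defs.v *)
From HB Require Import structures.
From mathcomp Require Import all_boot all_order all_algebra.
From mathcomp Require Import complex.
From mathcomp Require Import all_classical all_reals all_analysis.

Set Implicit Arguments.
Unset Strict Implicit.
Unset Printing Implicit Defensive.

Import Order.TTheory GRing.Theory Num.Theory.
Import numFieldNormedType.Exports.

Local Open Scope classical_set_scope.
Local Open Scope ring_scope.

(* The library norm on ['rV_n] is the sup norm (which induces the same
   topology), hence a separate Euclidean norm. *)
Definition enorm (R : realType) (n : nat) (x : 'rV[R]_n) : R :=
  Num.sqrt (\sum_(j < n) x ord0 j ^+ 2).

Definition O_invariant (R : realType) (n : nat) (U : set 'rV[R]_n) : Prop :=
  forall x x' : 'rV[R]_n, U x -> enorm x' = enorm x -> U x'.

(* [C1_on W g] and [C2_on W g] are meant for open [W] and finite-dimensional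
   [V]; then continuity of all the directional derivatives ['D_v g] amounts to
   continuity of the differential. *)
Definition C1_on (R : realType) (V : normedModType R) (W : set V) (g : V -> R)
    : Prop :=
  (forall z, W z -> differentiable g z) /\
  (forall v z, W z -> {for z, continuous ('D_v g)}).

Definition C2_on (R : realType) (V : normedModType R) (W : set V) (g : V -> R)
    : Prop :=
  C1_on W g /\ forall v, C1_on W ('D_v g).

(* C^n as a real normed space: the pair [(x, y)] stands for z = x + i y. *)
Definition Cn (R : realType) (n : nat) : normedModType R :=
  ('rV[R]_n * 'rV[R]_n)%type.

(* Directional derivative of a complex-valued function, computed on its real
   and imaginary parts. *)
Definition Cderive (R : realType) (n : nat) (g : Cn R n -> R[i]) (v : Cn R n)
    (z : Cn R n) : R[i] :=
  ('D_v (fun w => complex.Re (g w)) z +i* 'D_v (fun w => complex.Im (g w)) z)%C.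

Definition dx (R : realType) (n : nat) (j : 'I_n) (g : Cn R n -> R[i]) :
  Cn R n -> R[i] := Cderive g (delta_mx ord0 j, 0).

Definition dy (R : realType) (n : nat) (j : 'I_n) (g : Cn R n -> R[i]) :
  Cn R n -> R[i] := Cderive g (0, delta_mx ord0 j).

(* Wirtinger derivatives d/dz_j and d/d\bar z_j. *)
Definition dz (R : realType) (n : nat) (j : 'I_n) (g : Cn R n -> R[i])
    (z : Cn R n) : R[i] := (dx j g z - 'i * dy j g z) / 2.

Definition dzbar (R : realType) (n : nat) (j : 'I_n) (g : Cn R n -> R[i])
    (z : Cn R n) : R[i] := (dx j g z + 'i * dy j g z) / 2.

Definition toC (R : realType) (n : nat) (rho : Cn R n -> R) : Cn R n -> R[i] :=
  fun z => (rho z)%:C%C.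

Definition levi (R : realType) (n : nat) (rho : Cn R n -> R) (z : Cn R n)
    (v : 'rV[R[i]]_n) : R[i] :=
  \sum_(j < n) \sum_(k < n)
    dz j (dzbar k (toC rho)) z * v ord0 j * (v ord0 k)^*.

Definition complex_tangent (R : realType) (n : nat) (rho : Cn R n -> R)
    (p : Cn R n) : set 'rV[R[i]]_n :=
  [set v | \sum_(k < n) dz k (toC rho) p * v ord0 k = 0].

(* [rho] is a C^2 function on the open neighbourhood [W] of [Sigma] which
   presents [D] near [Sigma] as [{rho < 0}]. *)
Definition defining_function (R : realType) (n : nat) (D Sigma W : set (Cn R n))
    (rho : Cn R n -> R) : Prop :=
  [/\ open W, Sigma `<=` W, C2_on W rho &
  [/\ W `&` D = [set z | W z /\ rho z < 0],
      Sigma = [set z | W z /\ rho z = 0] &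
      forall p, Sigma p -> exists v : Cn R n, 'd rho p v != 0]].

(* The order of [R[i]] is partial: [0 < w] says that [w] is a positive real.
   The sign of the Levi form on complex tangent vectors does not depend on the
   defining function, so that a property of [(D, Sigma)] is obtained by asking
   for one defining function. *)
Definition strongly_pseudoconvex (R : realType) (n : nat)
    (D Sigma : set (Cn R n)) : Prop :=
  exists (W : set (Cn R n)) (rho : Cn R n -> R),
    defining_function D Sigma W rho /\
    forall p v, Sigma p -> complex_tangent rho p v -> v != 0 ->
      0 < levi rho p v.

Definition weakly_pseudoconvex (R : realType) (n : nat)
    (D Sigma : set (Cn R n)) : Prop :=
  exists (W : set (Cn R n)) (rho : Cn R n -> R),
    defining_function D Sigma W rho /\
    forall p v, Sigma p -> complex_tangent rho p v -> v != 0 ->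
      0 <= levi rho p v.

Definition Sigma_of (R : realType) (n : nat) (U : set 'rV[R]_n) (f : R -> R) :
  set (Cn R n) := [set z | U z.1 /\ enorm z.2 = f (enorm z.1)].

Definition D_minus (R : realType) (n : nat) (U : set 'rV[R]_n) (f : R -> R) :
  set (Cn R n) := [set z | U z.1 /\ enorm z.2 < f (enorm z.1)].

Definition D_plus (R : realType) (n : nat) (U : set 'rV[R]_n) (f : R -> R) :
  set (Cn R n) := [set z | U z.1 /\ f (enorm z.1) < enorm z.2].

(* Main.v *)
Require Import Defs.
From HB Require Import structures.
From mathcomp Require Import all_boot all_order all_algebra.
From mathcomp Require Import complex.
From mathcomp Require Import all_classical all_reals all_analysis.
From mathcomp Require Import ring lra.

Set Implicit Arguments.
Unset Strict Implicit.
Unset Printing Implicit Defensive.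

Import Order.TTheory GRing.Theory Num.Theory.
Import numFieldNormedType.Exports.

Local Open Scope classical_set_scope.
Local Open Scope ring_scope.

(** Write x = r e and y = f(r) u with e, u unit vectors, and let A = f f' / r
    and C = 1 - f (f'' + f'^3 / r).

    Sufficiency.  The function sigma (|y|^2 - f(|x|)^2), with sigma = 1 for the
    inner domain and sigma = -1 for the outer one, is a C^2 defining function
    over the whole tube U + i R^n.  Its real Hessian is explicit, and the Levi
    form of a function is one quarter of the Hessian trace on the real plane
    spanned by v and iv; hence on v = a + i b it equals
    (sigma / 2) ((1 - A) |v|^2 - (f'^2 + f f'' - A) |e.v|^2).  The complex
    tangent equation reads u.v = i f' (e.v).  It forces
    |v|^2 >= (1 + f'^2) |e.v|^2 ([bessel_tangent]): the vector
    (e.v) (e + i f' u) has squared length (1 + f'^2) |e.v|^2, whatever the angle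
    between e and u, and it is the orthogonal projection of v to the line that it
    spans.  Regrouping, the Levi form is (sigma / 2) ((1 - A) s + C t) with
    s, t >= 0 not both zero ([levi_tangent]), so that the signs of
    1 - A and C decide everything in the three parts.

    Necessity.  Here the defining function rho is arbitrary, and its Hessian is
    read off curves: if a curve g stays in Sigma, then differentiating
    rho (g t) = 0 twice gives
    Hess rho (g', g') = - d rho (g'') ([level_curve]).  With one curve tangent
    to v and another one tangent to iv, the Levi form at v becomes minus a
    quarter of d rho applied to the sum of two accelerations.  At points with
    u = e, and v real and orthogonal to e, this gives (1 - A) times a factor;
    at points with u orthogonal to e, and v = e + i f' u, the same factor times
    C.  The factor is a positive multiple of the derivative of rho in the
    direction (0, u), which is nonnegative because rho < 0 inside
    ([derive_outward_ge0]); positivity of the Levi form then makes 1 - A and C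
    positive.  All curves needed are in one family that rotates x and y in
    fixed planes while |x| moves at constant speed ([rotation_curve]). *)

(** * Derivatives in a direction *)

Section DirectionalDerivatives.
Context {R : realType} {V : normedModType R}.
Implicit Types (g h : V -> R) (z v w : V).

(** Differentiability is local: a function that vanishes near [z] is
    differentiable there, and [h] is [g] plus such a function. *)
Lemma near_eq_differentiable g h z :
  (\near z, g z = h z) -> differentiable g z -> differentiable h z.
Proof.
move=> gh dg.
have -> : h = g + (h - g) by rewrite addrC subrK.
apply: differentiableD => //.
have k0 : \forall w \near z, (h - g) w = 0.
  by apply: filterS gh => w /= gw; rewrite -[LHS]/(h w - g w) gw subrr.
move: (h - g) k0 => k k0 {h g gh dg}.
have kE : k \o shift z = cst (k z) + (\0 : V -> R) +o_ 0 id.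
  apply/eqaddoP => _/posnumP[e].
  have : \forall w \near (0 : V), k (w + z) = 0.
    by move: k0; rewrite (near_shift 0 z) subr0.
  apply: filterS => w kw.
  have kz := nbhs_singleton k0.
  by rewrite !fctE /= kw kz addr0 subrr normr0 mulr_ge0.
apply/diff_locallyP; rewrite (@diff_unique _ _ _ k \0) //.
- by split=> //; exact: cst_continuous.
- exact: cst_continuous.
Unshelve. all: by end_near. Qed.

Lemma deriveD_dir g z v w : differentiable g z ->
  'D_(v + w) g z = 'D_v g z + 'D_w g z.
Proof. by move=> dg; rewrite !deriveE// linearD. Qed.

Lemma deriveZ_dir g z a v : differentiable g z ->
  'D_(a *: v) g z = a * 'D_v g z.
Proof. by move=> dg; rewrite !deriveE// linearZ. Qed.

Lemma derive_sum_dir g z (I : Type) (s : seq I) (c : I -> R) (v : I -> V) :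
  differentiable g z ->
  'D_(\sum_(i <- s) c i *: v i) g z = \sum_(i <- s) c i * 'D_(v i) g z.
Proof.
move=> dg; rewrite deriveE// linear_sum; apply: eq_bigr => i _.
by rewrite linearZ deriveE.
Qed.

End DirectionalDerivatives.

(** * Stability of continuous differentiability *)

Section ContinuouslyDifferentiable.
Context {R : realType} {V : normedModType R}.
Implicit Types (g h : V -> R) (z v w : V) (W : set V).

Lemma near_eq_continuous_at (g h : V -> R) z :
  (\near z, g z = h z) -> {for z, continuous g} -> {for z, continuous h}.
Proof.
move=> gh cg; rewrite /prop_for /continuous_at -(nbhs_singleton gh).
exact: cvg_trans (near_eq_cvg gh) cg.
Qed.

(** The directional derivatives need to be known on [W] only, since [W] is
    open; this is how all closure properties below are obtained. *)
Lemma C1_onI W g (dg : V -> V -> R) : open W ->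
  (forall z, W z -> differentiable g z) ->
  (forall z v, W z -> 'D_v g z = dg v z) ->
  (forall v z, W z -> {for z, continuous (dg v)}) -> C1_on W g.
Proof.
move=> oW Dg dgE dgc; split=> // v z Wz.
apply: near_eq_continuous_at (dgc v z Wz).
have : \forall w \near z, W w by exact: open_nbhs_nbhs.
by apply: filterS => w Ww; rewrite dgE.
Qed.

Lemma C1_on_eq W g h : open W -> (forall z, W z -> g z = h z) ->
  C1_on W g -> C1_on W h.
Proof.
move=> oW gh [Dg cg].
have near_gh z : W z -> \near z, g z = h z.
  move=> Wz; have : \forall w \near z, W w by exact: open_nbhs_nbhs.
  by apply: filterS.
apply: (@C1_onI _ _ (fun v => 'D_v g)) => // [z Wz|z v Wz].
  exact: near_eq_differentiable (near_gh z Wz) (Dg z Wz).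
by apply/esym/near_eq_derive/near_gh.
Qed.

Lemma C1_on_continuous W g z : C1_on W g -> W z -> {for z, continuous g}.
Proof. by move=> [Dg _] /Dg/differentiable_continuous. Qed.

Lemma C1_on_cst W (c : R) : open W -> C1_on W (cst c).
Proof.
move=> oW; apply: (@C1_onI _ _ (fun _ => cst 0)) => // [z v _|v z _].
  exact: derive_cst.
exact: cst_continuous.
Qed.

Lemma C1_on_linear W g : open W -> (forall z, is_diff z g g) -> C1_on W g.
Proof.
move=> oW dg; apply: (@C1_onI _ _ (fun v => cst (g v))) => // [z v _|v z _].
  by rewrite deriveE// diff_val.
exact: cst_continuous.
Qed.

Lemma C1_onD W g h : open W -> C1_on W g -> C1_on W h ->
  C1_on W (fun z => g z + h z).
Proof.
move=> oW [Dg cg] [Dh ch].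
apply: (@C1_onI _ _ (fun v z => 'D_v g z + 'D_v h z)) =>
  // [z Wz|z v Wz|v z Wz].
- by apply: (@differentiableD _ _ _ g h); [exact: Dg|exact: Dh].
- by apply: (@deriveD _ _ _ g h); apply: diff_derivable; [exact: Dg|exact: Dh].
- by apply: continuousD; [exact: cg|exact: ch].
Qed.

Lemma C1_onM W g h : open W -> C1_on W g -> C1_on W h ->
  C1_on W (fun z => g z * h z).
Proof.
move=> oW C1g C1h; have [Dg cg] := C1g; have [Dh ch] := C1h.
apply: (@C1_onI _ _ (fun v z => g z * 'D_v h z + h z * 'D_v g z)) =>
  // [z Wz|z v Wz|v z Wz].
- by apply: (@differentiableM _ _ g h); [exact: Dg|exact: Dh].
- apply: (@deriveM _ _ g h); apply: diff_derivable; [exact: Dg|exact: Dh].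
- apply: continuousD; apply: continuousM.
  + exact: C1_on_continuous C1g Wz.
  + exact: ch.
  + exact: C1_on_continuous C1h Wz.
  + exact: cg.
Qed.

Lemma C1_onZ W (c : R) g : open W -> C1_on W g -> C1_on W (fun z => c * g z).
Proof. by move=> oW; apply: C1_onM => //; exact: C1_on_cst. Qed.

Lemma C1_on_sum W n (g : 'I_n -> V -> R) : open W ->
  (forall i, C1_on W (g i)) -> C1_on W (fun z => \sum_(i < n) g i z).
Proof.
move=> oW C1g; elim: n g C1g => [|n IH] g C1g.
  by rewrite (_ : (fun _ => _) = cst 0); [exact: C1_on_cst|
    apply/funext => z; rewrite big_ord0].
rewrite (_ : (fun _ => _) =
    fun z => g ord0 z + \sum_(i < n) g (lift ord0 i) z).
  by apply: C1_onD => //; apply: IH.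
by apply/funext => z; rewrite big_ord_recl.
Qed.

Lemma derive_comp (phi : R -> R) g z v :
  differentiable g z -> differentiable phi (g z) ->
  'D_v (phi \o g) z = 'D_1 phi (g z) * 'D_v g z.
Proof.
move=> Dg Dphi.
rewrite !deriveE//; last exact: differentiable_comp.
rewrite diff_comp//= -[X in 'd phi _ X]mulr1 -[_ * 1]/(_ *: (1 : R)).
by rewrite linearZ/= mulrC.
Qed.

Lemma C1_on_comp W (J : set R) (phi : R -> R) g : open W ->
  C1_on J phi -> C1_on W g -> (forall z, W z -> J (g z)) ->
  C1_on W (fun z => phi (g z)).
Proof.
move=> oW [Dphi cphi] C1g WJ; have [Dg cg] := C1g.
apply: (@C1_onI _ _ (fun v z => 'D_1 phi (g z) * 'D_v g z)) =>
  // [z Wz|z v Wz|v z Wz].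
- by apply: (@differentiable_comp _ _ _ _ g phi); [exact: Dg|exact/Dphi/WJ].
- by apply: derive_comp; [exact: Dg|exact/Dphi/WJ].
- apply: continuousM; last exact: cg.
  apply: (@continuous_comp _ _ _ g (fun s => 'D_1 phi s)).
    exact: C1_on_continuous C1g Wz.
  exact/cphi/WJ.
Qed.

End ContinuouslyDifferentiable.

Lemma C1_on_real {R : realType} (J : set R) (phi phi' : R -> R) : open J ->
  (forall s, J s -> is_derive s 1 phi (phi' s)) ->
  (forall s, J s -> {for s, continuous phi'}) -> C1_on J phi.
Proof.
move=> oJ dphi cphi.
have Dphi s : J s -> differentiable phi s.
  by move=> /dphi[Ds _]; exact/derivable1_diffP.
apply: (@C1_onI R R J phi (fun v s => v * phi' s)) => // [s v Js|v s Js].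
  rewrite -[v in LHS]mulr1 -[v * 1]/(v *: (1 : R)) deriveZ_dir; last exact: Dphi.
  by congr (_ * _); have [] := dphi s Js.
by apply: continuousM; [exact: cst_continuous|exact: cphi].
Qed.

Lemma open_gt0 {R : realType} : open [set s : R | 0 < s].
Proof. exact: open_gt. Qed.

Lemma C1_on_sqrt {R : realType} : C1_on [set s : R | 0 < s] Num.sqrt.
Proof.
apply: (C1_on_real open_gt0 (fun s s0 => is_derive1_sqrt s0)) => s s0.
apply: continuousV; first by rewrite mulf_neq0// gt_eqF// sqrtr_gt0.
by apply: continuousM; [exact: cst_continuous|exact: sqrt_continuous].
Qed.

Lemma C1_on_inv {R : realType} : C1_on [set s : R | 0 < s] GRing.inv.
Proof.
apply: (@C1_on_real _ _ _ (fun s => - s ^- 2)); first exact: open_gt0.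
  move=> s /= s0; apply: is_derive_eq.
    by apply: (@is_deriveV _ id s 1 1); rewrite gt_eqF.
  by rewrite /= -[X in X = _]/(_ * 1) mulr1.
move=> s /= s0; apply: continuousN; apply: continuousV.
  by rewrite expf_neq0// gt_eqF.
exact: exprn_continuous.
Qed.

(** * The Hessian and the Levi form *)

Definition hess (R : realType) (V : normedModType R) (rho : V -> R) (z v w : V) :
  R := 'D_v ('D_w rho) z.

Section HessianBilinear.
Context {R : realType} {V : normedModType R} (W : set V) (rho : V -> R) (z : V).
Hypotheses (oW : open W) (C2rho : C2_on W rho) (Wz : W z).
Implicit Types (u v w : V).

Let nearW : \forall y \near z, W y.
Proof. exact: open_nbhs_nbhs. Qed.

Let D1 y : W y -> differentiable rho y. Proof. by case: C2rho => -[D _] _ /D. Qed.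

Let D2 w : differentiable ('D_w rho) z.
Proof. by case: C2rho => _ /(_ w)[D _]; exact: D. Qed.

Lemma hessDl u v w : hess rho z (u + v) w = hess rho z u w + hess rho z v w.
Proof. exact/deriveD_dir/D2. Qed.

Lemma hessZl a u w : hess rho z (a *: u) w = a * hess rho z u w.
Proof. exact/deriveZ_dir/D2. Qed.

(** Linearity in the inner direction uses the identity of first derivatives on a
    whole neighbourhood of [z], unlike linearity in the outer one. *)
Lemma hessDr u v w : hess rho z u (v + w) = hess rho z u v + hess rho z u w.
Proof.
rewrite /hess -(@deriveD _ _ _ ('D_v rho) ('D_w rho)); do ?exact: diff_derivable.
apply: near_eq_derive; apply: filterS nearW => y Wy.
exact/deriveD_dir/D1.
Qed.

Lemma hessZr a u w : hess rho z u (a *: w) = a * hess rho z u w.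
Proof.
rewrite /hess -[RHS](@deriveZ _ _ _ ('D_w rho) a); last exact: diff_derivable.
apply: near_eq_derive; apply: filterS nearW => y Wy.
exact/deriveZ_dir/D1.
Qed.

Lemma hess_sumr u (I : Type) (s : seq I) (c : I -> V) :
  hess rho z u (\sum_(i <- s) c i) = \sum_(i <- s) hess rho z u (c i).
Proof.
have h0 : hess rho z u 0 = 0 by rewrite -(scale0r (0 : V)) hessZr mul0r.
exact: (big_morph (hess rho z u) (hessDr u) h0).
Qed.

Lemma hess_suml u (I : Type) (s : seq I) (c : I -> V) :
  hess rho z (\sum_(i <- s) c i) u = \sum_(i <- s) hess rho z (c i) u.
Proof.
have h0 : hess rho z 0 u = 0 by rewrite -(scale0r (0 : V)) hessZl mul0r.
exact: (big_morph (fun v => hess rho z v u) (fun v w => hessDl v w u) h0).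
Qed.

Lemma hess_comb2 a b c d u v u' v' :
  hess rho z (a *: u + b *: v) (c *: u' + d *: v') =
  a * c * hess rho z u u' + a * d * hess rho z u v' +
  b * c * hess rho z v u' + b * d * hess rho z v v'.
Proof.
rewrite hessDl !hessDr !hessZl !hessZr.
move: (hess rho z u u') (hess rho z u v') => xx xy.
by move: (hess rho z v u') (hess rho z v v') => yx yy; ring.
Qed.

End HessianBilinear.

Section LeviForm.
Context {R : realType} {n : nat}.
Implicit Types (rho : Cn R n -> R) (p : Cn R n) (v : 'rV[R[i]]_n).

(** The identification of C^n with pairs of real vectors, under which [mul_i] is
    multiplication by the imaginary unit. *)
Definition real_of v : Cn R n := (map_mx (@complex.Re R) v, map_mx (@complex.Im R) v).

Definition mul_i (w : Cn R n) : Cn R n := (- w.2, w.1).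

Let ex j : Cn R n := (delta_mx ord0 j, 0).
Let ey j : Cn R n := (0, delta_mx ord0 j).

Lemma real_basis_sum (a b : 'rV[R]_n) :
  (a, b) = \sum_j (a ord0 j *: ex j + b ord0 j *: ey j) :> Cn R n.
Proof.
have sumE (F : 'I_n -> Cn R n) : \sum_j F j = (\sum_j (F j).1, \sum_j (F j).2).
  by elim/big_rec3: _ => //= j x y _ _ ->.
rewrite sumE /=; congr (_, _).
  rewrite [LHS]row_sum_delta; apply: eq_bigr => j _.
  by rewrite scaler0 addr0.
rewrite [LHS]row_sum_delta; apply: eq_bigr => j _.
by rewrite scaler0 add0r.
Qed.

Let Ch (x y : R) : ((x +i* y) / 2 = (x / 2) +i* (y / 2))%C.
Proof.
apply: (@mulIf _ (2 : R[i])); first by rewrite pnatr_eq0.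
rewrite divfK ?pnatr_eq0//.
have -> : (2 : R[i]) = ((2 : R) +i* 0)%C by rewrite -[RHS]/(2%:C)%C rmorph_nat.
by simpc; rewrite !divfK// pnatr_eq0.
Qed.

Let Csub_i (a b c d : R) :
  ((a +i* b) - 'i * (c +i* d) = (a + d) +i* (b - c))%C.
Proof. by apply/eqP; rewrite eq_complex /=; apply/andP; split; apply/eqP; ring. Qed.

Let Cadd_i (a b c d : R) :
  ((a +i* b) + 'i * (c +i* d) = (a - d) +i* (b + c))%C.
Proof. by apply/eqP; rewrite eq_complex /=; apply/andP; split; apply/eqP; ring. Qed.

Lemma dz_complex j (g : Cn R n -> R[i]) z :
  dz j g z =
  (((('D_(ex j) (fun w => complex.Re (g w)) z +
      'D_(ey j) (fun w => complex.Im (g w)) z) / 2) +i*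
    (('D_(ex j) (fun w => complex.Im (g w)) z -
      'D_(ey j) (fun w => complex.Re (g w)) z) / 2)))%C.
Proof.
by rewrite -Ch -Csub_i.
Qed.

Lemma dzbar_toC k rho z :
  dzbar k (toC rho) z = (('D_(ex k) rho z / 2) +i* ('D_(ey k) rho z / 2))%C.
Proof.
rewrite /dzbar /dx /dy /Cderive Cadd_i Ch.
by rewrite /= !derive_cst subr0 add0r.
Qed.

Lemma dz_toC k rho z :
  dz k (toC rho) z = (('D_(ex k) rho z / 2) +i* (- 'D_(ey k) rho z / 2))%C.
Proof. by rewrite dz_complex /= !derive_cst addr0 sub0r. Qed.

Lemma Re_sum (I : Type) (s : seq I) (F : I -> R[i]) :
  complex.Re (\sum_(i <- s) F i) = \sum_(i <- s) complex.Re (F i).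
Proof. by apply: big_morph => // -[a b] [c d]. Qed.

Lemma Im_sum (I : Type) (s : seq I) (F : I -> R[i]) :
  complex.Im (\sum_(i <- s) F i) = \sum_(i <- s) complex.Im (F i).
Proof. by apply: big_morph => // -[a b] [c d]. Qed.

(** The real and imaginary parts of the complex equation are, up to the factors
    1/2 and - 1/2, the derivatives along [v] and [i v]: the complex tangent space
    is the largest complex subspace of the real one. *)
Lemma complex_tangentP rho p v : differentiable rho p ->
  complex_tangent rho p v <->
  'D_(real_of v) rho p = 0 /\ 'D_(mul_i (real_of v)) rho p = 0.
Proof.
move=> Drho.
have D_sum (a b : 'rV[R]_n) : 'D_((a, b) : Cn R n) rho p =
    \sum_j (a ord0 j * 'D_(ex j) rho p + b ord0 j * 'D_(ey j) rho p).
  rewrite (real_basis_sum a b) deriveE// linear_sum; apply: eq_bigr => j _.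
  by rewrite linearD !linearZ /= -!deriveE.
set S := \sum_(k < n) dz k (toC rho) p * v ord0 k.
have ReS : complex.Re S = 'D_(real_of v) rho p / 2.
  rewrite Re_sum D_sum mulr_suml; apply: eq_bigr => k _.
  rewrite dz_toC !mxE; move: ('D_(ex k) rho p) ('D_(ey k) rho p) => c d.
  by case: (v ord0 k) => a b /=; ring.
have ImS : complex.Im S = - 'D_(mul_i (real_of v)) rho p / 2.
  rewrite Im_sum D_sum mulNr mulr_suml -sumrN; apply: eq_bigr => k _.
  rewrite dz_toC !mxE; move: ('D_(ex k) rho p) ('D_(ey k) rho p) => c d.
  by case: (v ord0 k) => a b /=; ring.
rewrite /complex_tangent /= -/S; split => [S0|[V0 JV0]].
  have half0 (t : R) : 0 = t / 2 -> t = 0.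
    by move=> t0; rewrite -[t](divfK (negbT (pnatr_eq0 R 2))) -t0 mul0r.
  split; first by apply: half0; rewrite -ReS S0.
  by apply/eqP; rewrite -oppr_eq0; apply/eqP/half0; rewrite -ImS S0.
by apply/eqP; rewrite eq_complex ReS ImS V0 JV0 /= oppr0 mul0r eqxx.
Qed.

Section SecondOrder.
Variables (W : set (Cn R n)) (rho : Cn R n -> R) (p : Cn R n).
Hypotheses (oW : open W) (C2rho : C2_on W rho) (Wp : W p).

Lemma dz_dzbar_toC j k : dz j (dzbar k (toC rho)) p =
  (((hess rho p (ex j) (ex k) + hess rho p (ey j) (ey k)) / 4) +i*
   ((hess rho p (ex j) (ey k) - hess rho p (ey j) (ex k)) / 4))%C.
Proof.
have D2 w : differentiable ('D_w rho) p.
  by case: C2rho => _ /(_ w)[D _]; exact: D.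
have DZ s w : 'D_s (fun z => 'D_w rho z / 2) p = hess rho p s w / 2.
  rewrite [RHS]mulrC -[RHS](@deriveZ _ _ _ ('D_w rho)); last exact: diff_derivable.
  by congr ('D_s _ p); apply/funext => z; rewrite mulrC.
have ReE : (fun w => complex.Re (dzbar k (toC rho) w)) =
    fun w => 'D_(ex k) rho w / 2.
  by apply/funext => w; rewrite dzbar_toC.
have ImE : (fun w => complex.Im (dzbar k (toC rho) w)) =
    fun w => 'D_(ey k) rho w / 2.
  by apply/funext => w; rewrite dzbar_toC.
rewrite dz_complex ReE ImE {ReE ImE}.
move: (ex j) (ey j) (ex k) (ey k) => xj yj xk yk.
have quarter (a b : R) : (a / 2 + b / 2) / 2 = (a + b) / 4 by field.
congr (_ +i* _)%C; rewrite -quarter -?mulNr; congr ((_ + _) / 2); try exact: DZ.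
by rewrite mulNr; congr (- _); exact: DZ.
Qed.

Let hess_expand (a b c d : 'rV[R]_n) : hess rho p (a, b) (c, d) =
  \sum_j \sum_k (a ord0 j * c ord0 k * hess rho p (ex j) (ex k) +
                 a ord0 j * d ord0 k * hess rho p (ex j) (ey k) +
                 b ord0 j * c ord0 k * hess rho p (ey j) (ex k) +
                 b ord0 j * d ord0 k * hess rho p (ey j) (ey k)).
Proof.
rewrite (real_basis_sum a b) (real_basis_sum c d) (hess_suml C2rho Wp).
apply: eq_bigr => j _; rewrite (hess_sumr oW C2rho Wp).
by apply: eq_bigr => k _; exact: (hess_comb2 oW C2rho Wp).
Qed.

(** The antisymmetric part of the Hessian only enters the imaginary part of the
    Levi form ([Im_levi]); the real part is a Hessian trace over the real plane
    spanned by [v] and [i v]. *)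
Lemma Re_levi v : complex.Re (levi rho p v) =
  (hess rho p (real_of v) (real_of v) +
   hess rho p (mul_i (real_of v)) (mul_i (real_of v))) / 4.
Proof.
rewrite !hess_expand -big_split mulr_suml Re_sum; apply: eq_bigr => j _.
rewrite -big_split mulr_suml Re_sum; apply: eq_bigr => k _.
rewrite dz_dzbar_toC !mxE.
move: (hess rho p (ex j) (ex k)) (hess rho p (ex j) (ey k)) => xx xy.
move: (hess rho p (ey j) (ex k)) (hess rho p (ey j) (ey k)) => yx yy.
by case: (v ord0 j) (v ord0 k) => [a b] [c d] /=; ring.
Qed.

Lemma Im_levi v : complex.Im (levi rho p v) =
  (hess rho p (real_of v) (mul_i (real_of v)) -
   hess rho p (mul_i (real_of v)) (real_of v)) / 4.
Proof.
rewrite !hess_expand -sumrB mulr_suml Im_sum; apply: eq_bigr => j _.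
rewrite -sumrB mulr_suml Im_sum; apply: eq_bigr => k _.
rewrite dz_dzbar_toC !mxE.
move: (hess rho p (ex j) (ex k)) (hess rho p (ex j) (ey k)) => xx xy.
move: (hess rho p (ey j) (ex k)) (hess rho p (ey j) (ey k)) => yx yy.
by case: (v ord0 j) (v ord0 k) => [a b] [c d] /=; ring.
Qed.

End SecondOrder.
End LeviForm.

(** * Euclidean geometry of row vectors *)

Section EuclideanSpace.
Context {R : realType} {n : nat}.
Implicit Types (a b x y : 'rV[R]_n).

Definition dot a b : R := \sum_(j < n) a ord0 j * b ord0 j.

Lemma dotC a b : dot a b = dot b a.
Proof. by apply: eq_bigr => j _; rewrite mulrC. Qed.

Lemma dotDl a b x : dot (a + b) x = dot a x + dot b x.
Proof. by rewrite -big_split; apply: eq_bigr => j _; rewrite mxE mulrDl. Qed.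

Lemma dotZl c a x : dot (c *: a) x = c * dot a x.
Proof. by rewrite mulr_sumr; apply: eq_bigr => j _; rewrite mxE mulrA. Qed.

Lemma dotNl a x : dot (- a) x = - dot a x.
Proof. by rewrite -scaleN1r dotZl mulN1r. Qed.

Lemma dotDr a b x : dot x (a + b) = dot x a + dot x b.
Proof. by rewrite !(dotC x) dotDl. Qed.

Lemma dotZr c a x : dot x (c *: a) = c * dot x a.
Proof. by rewrite !(dotC x) dotZl. Qed.

Lemma dotNr a x : dot x (- a) = - dot x a.
Proof. by rewrite !(dotC x) dotNl. Qed.

Lemma dot_ge0 x : 0 <= dot x x.
Proof. by apply: sumr_ge0 => j _; rewrite -expr2 sqr_ge0. Qed.

Lemma dot_eq0 x : (dot x x == 0) = (x == 0).
Proof.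
apply/eqP/eqP => [x0|->]; last by rewrite -(scale0r 0) dotZl mul0r.
apply/rowP => j; rewrite mxE; apply/eqP; rewrite -sqrf_eq0 expr2.
by move: x0 => /psumr_eq0P-> // i _; rewrite -expr2 sqr_ge0.
Qed.

Lemma enormE x : enorm x = Num.sqrt (dot x x).
Proof. by congr Num.sqrt; apply: eq_bigr => j _; rewrite expr2. Qed.

Lemma enorm_ge0 x : 0 <= enorm x. Proof. exact: sqrtr_ge0. Qed.

Lemma enorm_sqr x : enorm x ^+ 2 = dot x x.
Proof. by rewrite enormE sqr_sqrtr// dot_ge0. Qed.

Lemma enorm_gt0 x : (0 < enorm x) = (x != 0).
Proof. by rewrite enormE sqrtr_gt0 lt_def dot_eq0 dot_ge0 andbT. Qed.

Lemma enorm_eq x r : 0 <= r -> dot x x = r ^+ 2 -> enorm x = r.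
Proof. by move=> r0 xr; rewrite enormE xr sqrtr_sqr ger0_norm. Qed.

Lemma enormZ c x : 0 <= c -> enorm (c *: x) = c * enorm x.
Proof.
move=> c0; apply: enorm_eq; first by rewrite mulr_ge0// enorm_ge0.
by rewrite dotZl dotZr exprMn enorm_sqr; ring.
Qed.

Lemma dot_unit x : x != 0 -> dot ((enorm x)^-1 *: x) ((enorm x)^-1 *: x) = 1.
Proof.
move=> x0; have r0 : enorm x != 0 by rewrite gt_eqF// enorm_gt0.
by rewrite dotZl dotZr -enorm_sqr; field.
Qed.

(** With [v = a + i b], the hypotheses say [u.v = i m (e.v)]. The inequality is
    [0 <= |v - w|^2] for [w = (e.v) (e + i m u)], the coefficients of which are
    written out in real terms below. The scalar product of [e] and [u] drops
    out, so that their angle is arbitrary. *)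
Lemma bessel_tangent (a b e u : 'rV[R]_n) m :
  dot e e = 1 -> dot u u = 1 ->
  dot u b = m * dot e a -> dot u a = - (m * dot e b) ->
  (1 + m ^+ 2) * (dot e a ^+ 2 + dot e b ^+ 2) <= dot a a + dot b b.
Proof.
move=> ee uu ub ua; set p := dot e a in ub *; set q := dot e b in ua *.
(* real and imaginary parts of v - (p + i q) (e + i m u) *)
have := dot_ge0 (a + ((- p) *: e + (m * q) *: u)).
have := dot_ge0 (b + ((- q) *: e + (- (m * p)) *: u)).
rewrite !(dotDl, dotDr, dotZl, dotZr) !(dotC a) !(dotC b) !(dotC u e) ee uu.
by rewrite ub ua -/p -/q; nra.
Qed.

(** If [x] has a nonzero coordinate [j], rotating coordinates [j] and [k] by a
    right angle gives a nonzero vector orthogonal to [x]. *)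
Lemma exists_orthonormal x : (1 < n)%N -> x != 0 ->
  exists w, dot w w = 1 /\ dot x w = 0.
Proof.
move=> n1 x0.
have [j xj] : exists j, x ord0 j != 0.
  apply/existsP; apply: contraNT x0; rewrite negb_exists => /forallP x0.
  by apply/eqP/rowP => j; rewrite mxE; apply/eqP; move: (x0 j); rewrite negbK.
have [k kj] : exists k : 'I_n, k != j.
  apply/existsP; apply: contraTT n1; rewrite negb_exists -leqNgt => /forallP nj.
  rewrite -[n]card_ord -(card1 j); apply: subset_leq_card.
  by apply/fintype.subsetP => i _; rewrite inE; move: (nj i); rewrite negbK.
have dot_delta y i : dot y (delta_mx ord0 i) = y ord0 i.
  rewrite /dot (bigD1 i)//= big1 ?mxE ?eqxx ?mulr1 ?addr0// => l li.
  by rewrite mxE (negbTE li) andbF mulr0.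
pose w : 'rV[R]_n :=
  x ord0 j *: delta_mx ord0 k + (- x ord0 k) *: delta_mx ord0 j.
have w0 : w != 0.
  apply/eqP => /rowP/(_ k); rewrite !mxE !eqxx (negbTE kj) /= mulr1 mulr0 addr0.
  by move=> xj0; rewrite xj0 eqxx in xj.
exists ((enorm w)^-1 *: w); split; first exact: dot_unit.
by rewrite dotZr dotDr !dotZr !dot_delta; ring.
Qed.

End EuclideanSpace.

(** * Quadratic functions of a linear projection *)

Section LinearProjection.
Context {R : realType} {V : normedModType R} {n : nat}.
Variable pi : {linear V -> 'rV[R]_n}.
Hypothesis pi_cont : continuous pi.
Implicit Types (a : 'rV[R]_n) (z w : V).

Lemma is_diff_linear (g : V -> R) z : linear g -> continuous g -> is_diff z g g.
Proof.
move=> lg cg; pose gM := GRing.isLinear.Build R V R *%R g lg.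
pose gL : {linear V -> R} := HB.pack g gM.
apply: DiffDef; first exact: (@linear_differentiable _ _ _ gL).
exact: (@diff_lin _ _ _ gL).
Qed.

Lemma coord_proj_continuous j : continuous (fun z => pi z ord0 j).
Proof.
move=> z; apply: (@continuous_comp _ _ _ pi (fun x : 'rV[R]_n => x ord0 j)).
  exact: pi_cont.
exact: coord_continuous.
Qed.

Lemma is_diff_coord_proj j z :
  is_diff z (fun w => pi w ord0 j) (fun w => pi w ord0 j).
Proof.
apply: is_diff_linear; last exact: coord_proj_continuous.
by move=> k u v; rewrite linearP !mxE.
Qed.

Lemma is_diff_dot_proj a z : is_diff z (fun w => dot (pi w) a) (fun w => dot (pi w) a).
Proof.
apply: is_diff_linear => [k u v|]; first by rewrite linearP dotDl dotZl.
rewrite (_ : (fun _ => _) =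
    \sum_(j < n) (fun w => pi w ord0 j * a ord0 j)); last first.
  by apply/funext => w; rewrite fct_sumE.
apply: (big_ind (fun g : V -> R => continuous g)) => [|g h cg ch|j _] w.
- exact: cst_continuous.
- by apply: continuousD; [exact: cg|exact: ch].
- apply: continuousM; first exact: coord_proj_continuous.
  exact: cst_continuous.
Qed.

Lemma dot_projE : (fun z => dot (pi z) (pi z)) =
  \sum_(j < n) (fun z => pi z ord0 j) * (fun z => pi z ord0 j).
Proof. by apply/funext => z; rewrite fct_sumE. Qed.

Lemma derive_dot_proj z w : 'D_w (fun z => dot (pi z) (pi z)) z = 2 * dot (pi z) (pi w).
Proof.
have Dj j : derivable (fun z => pi z ord0 j) z w.
  by apply: diff_derivable; have [D _] := is_diff_coord_proj j z.
rewrite dot_projE derive_sum; last by move=> j; exact: derivableM.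
rewrite mulr_sumr; apply: eq_bigr => j _.
rewrite deriveM//; have [D dE] := is_diff_coord_proj j z; rewrite deriveE// dE.
by rewrite -[_ *: _]/(_ * _) mulr2n mulrDl mul1r.
Qed.

Lemma C1_on_dot_proj (W : set V) : open W -> C1_on W (fun z => dot (pi z) (pi z)).
Proof.
move=> oW; apply: C1_on_sum => // j.
by apply: C1_onM => //; apply: C1_on_linear => // z; exact: is_diff_coord_proj.
Qed.

Lemma C1_on_dot_proj_cst (W : set V) a : open W -> C1_on W (fun z => dot (pi z) a).
Proof. by move=> oW; apply: C1_on_linear => // z; exact: is_diff_dot_proj. Qed.

Lemma derive_dot_proj_cst a z w : 'D_w (fun z => dot (pi z) a) z = dot (pi w) a.
Proof.
by have [D dE] := is_diff_dot_proj a z; rewrite deriveE// dE.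
Qed.

Lemma C1_on_enorm_proj (W : set V) : open W -> (forall z, W z -> pi z != 0) ->
  C1_on W (fun z => enorm (pi z)).
Proof.
move=> oW W0.
rewrite (_ : (fun _ => _) = fun z => Num.sqrt (dot (pi z) (pi z))); last first.
  by apply/funext => z; rewrite enormE.
apply: (C1_on_comp oW C1_on_sqrt (C1_on_dot_proj oW)) => z /W0 z0 /=.
by rewrite lt_def dot_eq0 z0 dot_ge0.
Qed.

Lemma derive_enorm_proj z w : pi z != 0 ->
  'D_w (fun z => enorm (pi z)) z = dot (pi z) (pi w) / enorm (pi z).
Proof.
move=> z0.
have dot0 : 0 < dot (pi z) (pi z) by rewrite lt_def dot_eq0 z0 dot_ge0.
rewrite (_ : (fun _ => _) = Num.sqrt \o (fun z => dot (pi z) (pi z))); last first.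
  by apply/funext => y; rewrite enormE.
rewrite derive_comp; last 2 first.
- by have [D _] := C1_on_dot_proj (@openT V); exact: D.
- by have [D _] := @C1_on_sqrt R; exact: D.
rewrite derive_sqrt// derive_dot_proj enormE; field.
by rewrite gt_eqF// sqrtr_gt0.
Qed.

End LinearProjection.

(** * The defining function over the tube *)

Lemma C1_onS {R : realType} {V : normedModType R} (W W' : set V) (g : V -> R) :
  W' `<=` W -> C1_on W g -> C1_on W' g.
Proof. by move=> WW' [D c]; split=> [z /WW'/D//|v z /WW'/c]. Qed.

Lemma derive_scaled_subM {R : realType} {V : normedModType R} (c : R)
    (g h k : V -> R) (z v : V) :
  derivable g z v -> derivable h z v -> derivable k z v ->
  'D_v (fun y => c * (g y - h y * k y)) z =
  c * ('D_v g z - (h z * 'D_v k z + k z * 'D_v h z)).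
Proof.
move=> dg dh dk.
have dhk := is_deriveM (derivableP dh) (derivableP dk).
have [_ D] := is_deriveZ c (is_deriveB (derivableP dg) dhk).
exact: D.
Qed.

Lemma derive_mul_div_id {R : realType} (g h : R -> R) (r : R) : r != 0 ->
  derivable g r 1 -> derivable h r 1 ->
  'D_1 (fun s => g s * h s / s) r =
  (('D_1 g r * h r + g r * 'D_1 h r) * r - g r * h r) / r ^+ 2.
Proof.
move=> r0 dg dh.
have dgh := is_deriveM (derivableP dg) (derivableP dh).
have [_ D] := is_deriveM dgh (is_deriveV r0 (is_derive_id r 1)).
rewrite [LHS]D -![_ *: _]/(_ * _) -[(g * h) r]/(g r * h r).
by move: ('D_1 g r) ('D_1 h r) => g' h'; field.
Qed.

Section TubeFunction.
Context {R : realType} {n : nat} (U : set 'rV[R]_n) (f : R -> R).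
Hypotheses (oU : open U) (U_0 : U `<=` ~` [set 0]).
Hypothesis f_C2 : C2_on (@enorm R n @` U) f.

Local Notation I := (@enorm R n @` U).
Local Notation f1 := ('D_1 f).
Local Notation f2 := ('D_1 ('D_1 f)).

Lemma base_neq0 x : U x -> x != 0.
Proof. by move=> Ux; apply/eqP => x0; apply: U_0 Ux _. Qed.

Lemma radii_gt0 : I `<=` [set r : R | 0 < r].
Proof. by move=> _ [x Ux <-] /=; rewrite enorm_gt0 base_neq0. Qed.

(** A point [r] of the set of radii moves inside it when [x] moves along its own
    ray. *)
Lemma open_radii : open I.
Proof.
rewrite openE => _ [x Ux <-].
have x0 := base_neq0 Ux; have r0 : 0 < enorm x by rewrite enorm_gt0.
pose ray (s : R) := s *: ((enorm x)^-1 *: x).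
have : \forall s \near enorm x, U (ray s).
  apply: (@scalel_continuous _ _ ((enorm x)^-1 *: x) (enorm x)).
  rewrite scalerA divff ?gt_eqF// scale1r.
  exact: open_nbhs_nbhs.
move=> nearU.
have near_gt0 : \forall s \near enorm x, 0 < s.
  by apply: open_nbhs_nbhs; split => //; exact: open_gt0.
apply: filterS2 nearU near_gt0 => s Us s0.
exists (ray s) => //; rewrite /ray enormZ; last exact: ltW.
by rewrite enormZ ?invr_ge0 ?ltW// mulVf ?mulr1// gt_eqF.
Qed.

Definition tube : set (Cn R n) := [set z | U z.1].

Lemma open_tube : open tube.
Proof. by apply: open_comp => // z _; exact: cvg_fst. Qed.

Let pi1 : {linear Cn R n -> 'rV[R]_n} := fst.
Let pi2 : {linear Cn R n -> 'rV[R]_n} := snd.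
Let pi1c : continuous pi1. Proof. by move=> z; exact: cvg_fst. Qed.
Let pi2c : continuous pi2. Proof. by move=> z; exact: cvg_snd. Qed.

Let radius_in (z : Cn R n) : tube z -> I (enorm z.1).
Proof. by move=> Uz; exists z.1. Qed.

Let C1f : C1_on I f. Proof. by case: f_C2. Qed.
Let C1f1 : C1_on I f1. Proof. by case: f_C2 => _ C1D; exact: C1D 1. Qed.

(** Half the derivative of [f(|x|)^2] in the direction [v] is [kappa (|x|)]
    times the scalar product of [x] and [v]. *)
Definition kappa (r : R) : R := f r * f1 r / r.

Lemma C1_kappa : C1_on I kappa.
Proof.
have oI := open_radii.
exact: (C1_onM oI (C1_onM oI C1f C1f1) (C1_onS radii_gt0 C1_on_inv)).
Qed.

Lemma derive_kappa r : I r ->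
  'D_1 kappa r = ((f1 r ^+ 2 + f r * f2 r) * r - f r * f1 r) / r ^+ 2.
Proof.
move=> Ir; have r0 : 0 < r := radii_gt0 Ir.
have D0 : derivable f r 1 by apply: diff_derivable; case: C1f => D _; exact: D.
have D1 : derivable f1 r 1 by apply: diff_derivable; case: C1f1 => D _; exact: D.
by rewrite [LHS](derive_mul_div_id _ D0 D1) ?gt_eqF.
Qed.

(** Squares are used rather than [|y| - f(|x|)] so that the function is C^2 also
    on the zero section [y = 0]. *)
Definition tube_fun (sigma : R) (z : Cn R n) : R :=
  sigma * (dot z.2 z.2 - f (enorm z.1) ^+ 2).

Let radius (z : Cn R n) := enorm z.1.

Let pi1_neq0 (z : Cn R n) : tube z -> pi1 z != 0.
Proof. exact: base_neq0. Qed.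

Let C1_radius : C1_on tube radius.
Proof. exact: (C1_on_enorm_proj pi1c open_tube pi1_neq0). Qed.

Let derive_radius z v : tube z -> 'D_v radius z = dot z.1 v.1 / enorm z.1.
Proof. by move=> Uz; apply: (derive_enorm_proj pi1c); exact: pi1_neq0. Qed.

Let C1_comp_radius phi : C1_on I phi -> C1_on tube (fun z => phi (radius z)).
Proof. by move=> C1phi; exact: (C1_on_comp open_tube C1phi C1_radius radius_in). Qed.

Let derive_comp_radius phi z v : C1_on I phi -> tube z ->
  'D_v (fun z => phi (radius z)) z = 'D_1 phi (radius z) * (dot z.1 v.1 / radius z).
Proof.
move=> C1phi Uz; rewrite -derive_radius//; apply: derive_comp.
  by have [D _] := C1_radius; exact: D.
by have [D _] := C1phi; apply: D; exact: radius_in.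
Qed.

Let C1D (g : Cn R n -> R) z v (C1g : C1_on tube g) (Uz : tube z) :
  derivable g z v.
Proof. by case: C1g => D _; exact/diff_derivable/D. Qed.

Lemma C1_tube_fun sigma : C1_on tube (tube_fun sigma).
Proof.
rewrite (_ : tube_fun sigma = fun z => sigma * (dot (pi2 z) (pi2 z) +
    (-1) * (f (radius z) * f (radius z)))); last first.
  by apply/funext => z; rewrite /tube_fun mulN1r expr2.
have oT := open_tube.
have Cf := C1_comp_radius C1f; have C2 := C1_on_dot_proj pi2c oT.
exact: (C1_onZ _ oT (C1_onD oT C2 (C1_onZ _ oT (C1_onM oT Cf Cf)))).
Qed.

Lemma derive_tube_fun sigma z v : tube z ->
  'D_v (tube_fun sigma) z =
  2 * sigma * (dot z.2 v.2 - kappa (enorm z.1) * dot z.1 v.1).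
Proof.
move=> Uz; have oT := open_tube.
have Cf := C1_comp_radius C1f; have C2 := C1_on_dot_proj pi2c oT.
have dF := @C1D _ z v Cf Uz; have d2 := @C1D _ z v C2 Uz.
have tubeE : tube_fun sigma = fun w =>
    sigma * (dot (pi2 w) (pi2 w) - f (radius w) * f (radius w)).
  by apply/funext => w; rewrite /tube_fun expr2.
rewrite tubeE [LHS](derive_scaled_subM sigma d2 dF dF).
rewrite (derive_dot_proj pi2c) (@derive_comp_radius f z v C1f Uz) /kappa /radius.
by rewrite /pi2 /=; ring.
Qed.

Let grad sigma (v z : Cn R n) : R := 2 * sigma *
  (dot (pi2 z) v.2 + (-1) * (kappa (radius z) * dot (pi1 z) v.1)).

Let gradE sigma v z : tube z -> 'D_v (tube_fun sigma) z = grad sigma v z.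
Proof. by move=> Uz; rewrite derive_tube_fun// /grad mulN1r. Qed.

Lemma C2_tube_fun sigma : C2_on tube (tube_fun sigma).
Proof.
split; first exact: C1_tube_fun.
move=> v; apply: (@C1_on_eq _ _ _ (grad sigma v)); first exact: open_tube.
  by move=> z /gradE->.
have oT := open_tube.
have Ck := C1_comp_radius C1_kappa.
have l1 := C1_on_dot_proj_cst pi1c v.1 oT.
have l2 := C1_on_dot_proj_cst pi2c v.2 oT.
exact: (C1_onZ _ oT (C1_onD oT l2 (C1_onZ _ oT (C1_onM oT Ck l1)))).
Qed.

Lemma hess_tube_fun sigma z w v : tube z ->
  hess (tube_fun sigma) z w v = 2 * sigma * (dot w.2 v.2 -
    ('D_1 kappa (enorm z.1) / enorm z.1 * (dot z.1 w.1 * dot z.1 v.1) +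
     kappa (enorm z.1) * dot w.1 v.1)).
Proof.
move=> Uz; have oT := open_tube.
have near_grad : \near z, 'D_v (tube_fun sigma) z = grad sigma v z.
  have : \forall y \near z, tube y by exact: open_nbhs_nbhs.
  by apply: filterS => y; exact: gradE.
rewrite /hess (near_eq_derive _ near_grad).
have Ck := C1_comp_radius C1_kappa.
have dF := @C1D _ z w Ck Uz.
have d1 := @C1D _ z w (C1_on_dot_proj_cst pi1c v.1 oT) Uz.
have d2 := @C1D _ z w (C1_on_dot_proj_cst pi2c v.2 oT) Uz.
have gradE' : grad sigma v = fun y => (2 * sigma) *
    (dot (pi2 y) v.2 - kappa (radius y) * dot (pi1 y) v.1).
  by apply/funext => y; rewrite /grad mulN1r.
rewrite gradE' [LHS](derive_scaled_subM (2 * sigma) d2 dF d1).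
rewrite (derive_dot_proj_cst pi2c) (derive_dot_proj_cst pi1c).
rewrite (@derive_comp_radius kappa z w C1_kappa Uz) /radius /pi1 /pi2 /=.
by ring.
Qed.

End TubeFunction.

(** * Sufficient conditions *)

Section LeviOfTube.
Context {R : realType} {n : nat} (U : set 'rV[R]_n) (f : R -> R).
Hypotheses (oU : open U) (U_0 : U `<=` ~` [set 0]).
Hypothesis f_gt0 : forall r, (@enorm R n @` U) r -> 0 < f r.
Hypothesis f_C2 : C2_on (@enorm R n @` U) f.

Local Notation f1 := ('D_1 f).
Local Notation f2 := ('D_1 ('D_1 f)).

(** The two numbers that govern the Levi form: [levi_normal] is its value for
    [sigma = 1], up to a positive factor, on vectors orthogonal to [x] and [y],
    and [levi_radial] on the vector [e + i f' u] when [e] and [u] are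
    orthogonal. *)
Definition levi_normal (r : R) : R := 1 - f r * f1 r / r.
Definition levi_radial (r : R) : R := 1 - f r * (f2 r + f1 r ^+ 3 / r).

Lemma levi_normal_gt0 r : (0 < levi_normal r) = (f r * f1 r / r < 1).
Proof. exact: subr_gt0. Qed.

Lemma levi_radial_gt0 r :
  (0 < levi_radial r) = (f r * (f2 r + f1 r ^+ 3 / r) < 1).
Proof. exact: subr_gt0. Qed.

Lemma levi_normal_lt0 r : (levi_normal r < 0) = (1 < f r * f1 r / r).
Proof. exact: subr_lt0. Qed.

Lemma levi_radial_lt0 r :
  (levi_radial r < 0) = (1 < f r * (f2 r + f1 r ^+ 3 / r)).
Proof. exact: subr_lt0. Qed.

Lemma levi_radial_eq0 r :
  f r * (f2 r + f1 r ^+ 3 / r) = 1 -> levi_radial r = 0.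
Proof. by rewrite /levi_radial => ->; rewrite subrr. Qed.

Lemma levi_tube_fun sigma (p : Cn R n) (v : 'rV[R[i]]_n) : tube U p ->
  let a := (real_of v).1 in let b := (real_of v).2 in let r := enorm p.1 in
  levi (tube_fun f sigma) p v =
  (sigma / 2 * ((1 - kappa f r) * (dot a a + dot b b) -
     'D_1 (kappa f) r / r * (dot p.1 a ^+ 2 + dot p.1 b ^+ 2)))%:C%C.
Proof.
move=> Up a b r; have oT := open_tube oU; have C2 := C2_tube_fun oU U_0 f_C2 sigma.
apply/eqP; rewrite eq_complex (Re_levi oT C2 Up) (Im_levi oT C2 Up).
rewrite !(hess_tube_fun oU U_0 f_C2 sigma _ _ Up) -/r.
rewrite -[(mul_i _).1]/(- b) -[(mul_i _).2]/a -/a -/b !dotNl !dotNr !(dotC b a).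
move: (kappa f r) ('D_1 (kappa f) r) => k k'.
rewrite opprK; apply/andP; split; apply/eqP => /=; field.
  by rewrite gt_eqF// enorm_gt0 (base_neq0 U_0).
by rewrite gt_eqF// enorm_gt0 (base_neq0 U_0).
Qed.

(** Here [t = |e.v|^2] and [s = |v|^2 - (1 + f'^2) t]; the sign of [s] is
    [bessel_tangent], and [(1 - A) f'^2 + 1 - f'^2 - f f'' = levi_radial] explains
    the coefficient of [t]. *)
Lemma levi_tangent sigma (p : Cn R n) (v : 'rV[R[i]]_n) : sigma != 0 ->
  Sigma_of U f p -> complex_tangent (tube_fun f sigma) p v ->
  exists s t, [/\ 0 <= s, 0 <= t, s = 0 -> t = 0 -> v = 0 &
    levi (tube_fun f sigma) p v = (sigma / 2 *
      (levi_normal (enorm p.1) * s + levi_radial (enorm p.1) * t))%:C%C].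
Proof.
move=> sigma0 [Up yf]; set r := enorm p.1 in yf *.
have Ir : (@enorm R n @` U) r by exists p.1.
have r0 : 0 < r by exact: radii_gt0 Ir.
have fr0 : 0 < f r by exact: f_gt0.
have x0 : p.1 != 0 by rewrite -enorm_gt0.
have y0 : p.2 != 0 by rewrite -enorm_gt0 yf.
have [[DT _] _] := C2_tube_fun oU U_0 f_C2 sigma.
move/(complex_tangentP _ (DT p Up)).
rewrite !(derive_tube_fun oU U_0 f_C2 sigma _ Up) (levi_tube_fun _ _ Up) -/r.
set a := (real_of v).1; set b := (real_of v).2.
rewrite -[(mul_i _).1]/(- b) -[(mul_i _).2]/a dotNr => -[tb ta].
have sN0 : 2 * sigma != 0 by rewrite mulf_neq0// pnatr_eq0.
have {}tb : dot p.2 b = kappa f r * dot p.1 a.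
  by apply/eqP; rewrite -subr_eq0; move/eqP: tb; rewrite mulf_eq0 (negbTE sN0).
have {}ta : dot p.2 a = - (kappa f r * dot p.1 b).
  apply/eqP; rewrite -subr_eq0 -mulrN; move/eqP: ta.
  by rewrite mulf_eq0 (negbTE sN0).
pose e := r^-1 *: p.1; pose u := (f r)^-1 *: p.2.
have ee : dot e e = 1 by exact: dot_unit.
have uu : dot u u = 1 by rewrite /u -yf; exact: dot_unit.
have xE w : dot p.1 w = r * dot e w.
  by rewrite dotZl mulrA divff ?mul1r// gt_eqF.
have kE : kappa f r = f r * f1 r / r by [].
have ub : dot u b = f1 r * dot e a.
  rewrite [LHS]dotZl tb kE xE; move: (f1 r) (dot e a) => m c.
  by field; rewrite !gt_eqF.
have ua : dot u a = - (f1 r * dot e b).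
  rewrite [LHS]dotZl ta kE xE; move: (f1 r) (dot e b) => m c.
  by field; rewrite !gt_eqF.
have bessel := bessel_tangent ee uu ub ua.
exists (dot a a + dot b b - (1 + f1 r ^+ 2) * (dot e a ^+ 2 + dot e b ^+ 2)).
exists (dot e a ^+ 2 + dot e b ^+ 2); split.
- by rewrite subr_ge0.
- by rewrite addr_ge0// sqr_ge0.
- move=> s0 t0; move: s0; rewrite t0 mulr0 subr0 => /eqP.
  rewrite paddr_eq0 ?dot_ge0// !dot_eq0 => /andP[/eqP a0 /eqP b0].
  apply/rowP => j; apply/eqP; rewrite eq_complex !mxE.
  have := congr1 (fun w : 'rV[R]_n => w ord0 j) a0.
  have := congr1 (fun w : 'rV[R]_n => w ord0 j) b0.
  by rewrite !mxE => -> ->; rewrite !eqxx.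
congr (_%:C)%C; congr (_ * _).
rewrite (derive_kappa U_0 f_C2 Ir) kE !xE /levi_normal /levi_radial.
move: (f1 r) (f2 r) (dot e a) (dot e b) (dot a a) (dot b b) => m m' c d aa bb.
by field; rewrite gt_eqF.
Qed.

Lemma tube_defining_function sigma (D : set (Cn R n)) : sigma != 0 ->
  (forall z, tube U z -> D z <-> tube_fun f sigma z < 0) ->
  defining_function D (Sigma_of U f) (tube U) (tube_fun f sigma).
Proof.
move=> sigma0 DE; have C2 := C2_tube_fun oU U_0 f_C2 sigma.
have f0 z : tube U z -> 0 < f (enorm z.1) by move=> Uz; apply: f_gt0; exists z.1.
split; [exact: open_tube|by move=> z []|exact: C2|].
split.
- by apply/seteqP; split=> z /= [Uz] /(DE z Uz).
- apply/seteqP; split=> z /= [Uz].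
    by rewrite /tube_fun => zf; split=> //; rewrite -enorm_sqr zf subrr mulr0.
  move=> /eqP; rewrite mulf_eq0 (negbTE sigma0) subr_eq0 -enorm_sqr /= => zf.
  split=> //; apply/eqP; move: zf; rewrite eqrXn2// ?enorm_ge0//.
  exact/ltW/f0.
- move=> p [Up yf]; exists (0, p.2).
  have [[DT _] _] := C2; rewrite -deriveE; last exact: DT.
  rewrite (derive_tube_fun oU U_0 f_C2 sigma _ Up) /= -(scale0r 0) dotZr mul0r.
  have fN0 : f (enorm p.1) != 0 by rewrite gt_eqF// f0.
  rewrite mulr0 subr0 -enorm_sqr yf mulf_neq0 ?expf_neq0//.
  by rewrite mulf_neq0// pnatr_eq0.
Qed.

Lemma D_minus_tube_fun z : tube U z -> D_minus U f z <-> tube_fun f 1 z < 0.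
Proof.
move=> Uz; have f0 : 0 < f (enorm z.1) by apply: f_gt0; exists z.1.
rewrite /tube_fun mul1r subr_lt0 -enorm_sqr ltr_pXn2r ?nnegrE ?enorm_ge0 ?ltW//.
by split=> [[]|]; [|split].
Qed.

Lemma D_plus_tube_fun z : tube U z -> D_plus U f z <-> tube_fun f (-1) z < 0.
Proof.
move=> Uz; have f0 : 0 < f (enorm z.1) by apply: f_gt0; exists z.1.
rewrite /tube_fun mulN1r oppr_lt0 subr_gt0 -enorm_sqr ltr_pXn2r ?nnegrE ?enorm_ge0 ?ltW//.
by split=> [[]|]; [|split].
Qed.

Lemma strongly_pseudoconvex_tube sigma (D : set (Cn R n)) : sigma != 0 ->
  (forall z, tube U z -> D z <-> tube_fun f sigma z < 0) ->
  (forall x, U x -> 0 < sigma * levi_normal (enorm x) /\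
                    0 < sigma * levi_radial (enorm x)) ->
  strongly_pseudoconvex D (Sigma_of U f).
Proof.
move=> sigma0 DE pos; exists (tube U), (tube_fun f sigma).
split; first exact: tube_defining_function.
move=> p v Sp tv v0; have [s [t [s0 t0 st ->]]] := levi_tangent sigma0 Sp tv.
rewrite ltcR; have [A C] := pos p.1 Sp.1.
have : 0 < s \/ 0 < t.
  apply/orP; rewrite !lt_def s0 t0 !andbT -negb_and; apply: contra v0.
  by move=> /andP[/eqP s_0 /eqP t_0]; rewrite st.
move: (levi_normal _) (levi_radial _) A C => A C sA sC st0.
have -> : sigma / 2 * (A * s + C * t) = (sigma * A * s + sigma * C * t) / 2.
  by ring.
apply: divr_gt0 => //; case: st0 => [s_gt0|t_gt0].
  by apply: ltr_wpDr; [rewrite mulr_ge0// ltW|rewrite mulr_gt0].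
  by apply: ltr_wpDl; [rewrite mulr_ge0// ltW|rewrite mulr_gt0].
Qed.

Lemma weakly_pseudoconvex_tube sigma (D : set (Cn R n)) : sigma != 0 ->
  (forall z, tube U z -> D z <-> tube_fun f sigma z < 0) ->
  (forall x, U x -> 0 <= sigma * levi_normal (enorm x) /\
                    0 <= sigma * levi_radial (enorm x)) ->
  weakly_pseudoconvex D (Sigma_of U f).
Proof.
move=> sigma0 DE pos; exists (tube U), (tube_fun f sigma).
split; first exact: tube_defining_function.
move=> p v Sp tv v0; have [s [t [s0 t0 _ ->]]] := levi_tangent sigma0 Sp tv.
rewrite lecR; have [A C] := pos p.1 Sp.1.
move: (levi_normal _) (levi_radial _) A C => A C sA sC.
have -> : sigma / 2 * (A * s + C * t) = (sigma * A * s + sigma * C * t) / 2.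
  by ring.
by apply: divr_ge0 => //; rewrite addr_ge0// mulr_ge0.
Qed.

End LeviOfTube.

(** * Curves in the zero set of a function *)

Section CurvesInLevelSets.
Context {R : realType} {V : normedModType R} {m : nat}.
Variables (W : set V) (rho : V -> R).
Hypotheses (oW : open W) (C2rho : C2_on W rho).
Variables (c c1 : 'I_m -> R -> R) (c2 : 'I_m -> R) (E : 'I_m -> V).

(** Curves with values in the span of finitely many fixed vectors: for these the
    second derivative of a composite only involves derivatives in fixed
    directions. *)
Definition curve (t : R) : V := \sum_i c i t *: E i.

Hypothesis dc : forall i, \forall t \near (0 : R), is_derive t (1 : R) (c i) (c1 i t).
Hypothesis dc1 : forall i, is_derive (0 : R) (1 : R) (c1 i) (c2 i).
Hypothesis W0 : W (curve 0).

Let curveE : curve = \sum_i (fun t => c i t *: E i).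
Proof. by apply/funext => t; rewrite fct_sumE. Qed.

Let differentiable_curve t : (forall i, is_derive t (1 : R) (c i) (c1 i t)) ->
  differentiable curve t.
Proof.
move=> dct; rewrite curveE; apply: differentiable_sum => i.
apply: differentiableZl; apply/derivable1_diffP.
by have [] := dct i.
Qed.

Lemma derive_along_curve (g : V -> R) t :
  (forall i, is_derive t (1 : R) (c i) (c1 i t)) -> differentiable g (curve t) ->
  is_derive t (1 : R) (g \o curve) (\sum_i c1 i t * 'D_(E i) g (curve t)).
Proof.
move=> dct dg; have dcurve := differentiable_curve dct.
have dgc : differentiable (g \o curve) t by exact: differentiable_comp.
have [Dct ct] : (forall i, differentiable (c i) t) /\
    (forall i, 'd (c i) t 1 = c1 i t).
  have D i : differentiable (c i) t.
    by apply/derivable1_diffP; have [] := dct i.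
  by split=> // i; rewrite -deriveE//; have [] := dct i.
apply: DeriveDef; first exact: diff_derivable.
rewrite deriveE// diff_comp//= -derive_sum_dir// deriveE//; congr ('d g _ _).
rewrite -deriveE// curveE derive_sum; last first.
  by move=> i; apply: diff_derivable; exact: differentiableZl.
apply: eq_bigr => i _; rewrite deriveE; last exact: differentiableZl.
by rewrite diffZl// ct.
Qed.

Hypothesis rho0 : \forall t \near (0 : R), rho (curve t) = 0.

(** The first two derivatives of [rho] along the curve vanish: the second one
    is the Hessian on the velocity plus the derivative along the acceleration. *)
Lemma level_curve :
  let v := \sum_i c1 i 0 *: E i in
  'D_v rho (curve 0) = 0 /\
  hess rho (curve 0) v v + 'D_(\sum_i c2 i *: E i) rho (curve 0) = 0.
Proof.
move=> v.
have dc0 : \forall t \near (0 : R), forall i, is_derive t (1 : R) (c i) (c1 i t).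
  exact: (@filter_forall _ _
    (fun i => [set t | is_derive t (1 : R) (c i) (c1 i t)]) _ _ dc).
have dct0 := nbhs_singleton dc0.
have Wc : \forall t \near (0 : R), W (curve t).
  have nW : nbhs (curve 0) W by exact: open_nbhs_nbhs.
  exact: (differentiable_continuous (differentiable_curve dct0) nW).
have D1 y : W y -> differentiable rho y by case: C2rho => -[D _] _ /D.
have D2 w y : W y -> differentiable ('D_w rho) y.
  by case: C2rho => _ /(_ w)[D _] /D.
pose G t := \sum_i c1 i t * 'D_(E i) rho (curve t).
have G0 : \forall t \near (0 : R), G t = 0.
  have nrho0 : \forall t \near (0 : R), \forall s \near t, rho (curve s) = 0.
    exact: near_join.
  apply: filterS3 dc0 Wc nrho0 => t dct Wt rho_t.
  rewrite /G; have [_ <-] := derive_along_curve dct (D1 _ Wt).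
  have -> : 'D_1 (rho \o curve) t = 'D_1 (cst 0) t by exact: near_eq_derive.
  exact: derive_cst.
split; first by rewrite /v derive_sum_dir; [exact: nbhs_singleton G0|exact: D1].
have dG : is_derive (0 : R) 1 G (\sum_i (c1 i 0 * hess rho (curve 0) v (E i) +
    'D_(E i) rho (curve 0) * c2 i)).
  rewrite (_ : G = \sum_i (c1 i * ('D_(E i) rho \o curve))); last first.
    by apply/funext => t; rewrite fct_sumE.
  apply: is_derive_sum => i.
  have := derive_along_curve dct0 (D2 (E i) _ W0).
  rewrite -derive_sum_dir; last exact: D2.
  exact: is_deriveM.
have [_ dG0] := dG.
have : 'D_1 G 0 = 0.
  have -> : 'D_1 G 0 = 'D_1 (cst 0) (0 : R) by exact: near_eq_derive.
  exact: derive_cst.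
rewrite dG0 big_split /= => S0; rewrite -[RHS]S0; congr (_ + _).
  rewrite [LHS](hess_sumr oW C2rho W0 v).
  by apply: eq_bigr => i _; exact: (hessZr oW C2rho W0).
rewrite derive_sum_dir; last exact: D1.
by apply: eq_bigr => i _; rewrite mulrC.
Qed.

End CurvesInLevelSets.

Lemma derive_ge0_of_backward_le {R : realType} {V : normedModType R} (g : V -> R)
    (a v : V) :
  derivable g a v -> (\forall t \near (0 : R), t < 0 -> g (t *: v + a) <= g a) ->
  0 <= 'D_v g a.
Proof.
move=> dg gle; rewrite ['D_v g a](cvg_at_leftE _ 0 dg).
apply: limr_ge.
  rewrite -(cvg_at_leftE (fun h => h^-1 *: ((g \o shift a) _ - g a)))//.
  apply: cvg_trans dg; apply: cvg_app.
  move=> A [e egt0 Ae]; exists e => // x xe xgt0; apply: Ae => //.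
  exact/ltr0_neq0.
move: gle => [e e0 eg]; exists e => // h he h0.
apply: mulr_le0; first by rewrite invr_le0 ltW.
by rewrite subr_le0 /=; exact: eg.
Qed.

(** * Curves in the hypersurface *)

Section Polar.
Context {R : realType}.
Variables (F F1 : R -> R) (F2 beta : R).
Hypothesis dF : \forall t \near (0 : R), is_derive t (1 : R) F (F1 t).
Hypothesis dF1 : is_derive (0 : R) (1 : R) F1 F2.

Let dlin (t : R) : is_derive t (1 : R) (fun s => beta * s) beta.
Proof.
have [D DE] := is_deriveZ beta (is_derive_id t (1 : R)).
by apply: DeriveDef D _; rewrite DE -[_ *: _]/(_ * _) mulr1.
Qed.

Let dcos t : is_derive t (1 : R) (fun s => cos (beta * s)) (- sin (beta * t) * beta).
Proof. exact: (is_derive1_comp (is_derive_cos (beta * t)) (dlin t)). Qed.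

Let dsin t : is_derive t (1 : R) (fun s => sin (beta * s)) (cos (beta * t) * beta).
Proof. exact: (is_derive1_comp (is_derive_sin (beta * t)) (dlin t)). Qed.

Let dM (g h : R -> R) (t g' h' d : R) : is_derive t (1 : R) g g' ->
  is_derive t (1 : R) h h' -> g t * h' + h t * g' = d ->
  is_derive t (1 : R) (fun s => g s * h s) d.
Proof. by move=> dg dh <-; exact: (is_deriveM dg dh). Qed.

Let dD (g h : R -> R) (t g' h' : R) : is_derive t (1 : R) g g' ->
  is_derive t (1 : R) h h' ->
  is_derive t (1 : R) (fun s => g s + h s) (g' + h').
Proof. by move=> dg dh; exact: (is_deriveD dg dh). Qed.

Let dF0 : is_derive (0 : R) (1 : R) F (F1 0).
Proof. exact: nbhs_singleton dF. Qed.

Lemma is_derive_polar_cos : \forall t \near (0 : R),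
  is_derive t (1 : R) (fun s => F s * cos (beta * s))
    (F1 t * cos (beta * t) + F t * (- beta * sin (beta * t))).
Proof. by apply: filterS dF => t dFt; apply: dM dFt (dcos t) _; ring. Qed.

Lemma is_derive_polar_sin : \forall t \near (0 : R),
  is_derive t (1 : R) (fun s => F s * sin (beta * s))
    (F1 t * sin (beta * t) + F t * (beta * cos (beta * t))).
Proof. by apply: filterS dF => t dFt; apply: dM dFt (dsin t) _; ring. Qed.

Let dcst (k t : R) : is_derive t (1 : R) (fun _ : R => k) 0.
Proof. exact: is_derive_cst. Qed.

Lemma is_derive2_polar_cos : is_derive (0 : R) (1 : R)
  (fun t => F1 t * cos (beta * t) + F t * (- beta * sin (beta * t)))
  (F2 - F 0 * beta ^+ 2).
Proof.
have d1 := dM dF1 (dcos 0) erefl.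
have d2 := dM dF0 (dM (dcst (- beta) 0) (dsin 0) erefl) erefl.
have [D DE] := dD d1 d2; apply: DeriveDef D _; rewrite [LHS]DE.
by rewrite mulr0 cos0 sin0; ring.
Qed.

Lemma is_derive2_polar_sin : is_derive (0 : R) (1 : R)
  (fun t => F1 t * sin (beta * t) + F t * (beta * cos (beta * t)))
  (2 * F1 0 * beta).
Proof.
have d1 := dM dF1 (dsin 0) erefl.
have d2 := dM dF0 (dM (dcst beta 0) (dcos 0) erefl) erefl.
have [D DE] := dD d1 d2; apply: DeriveDef D _; rewrite [LHS]DE.
by rewrite mulr0 cos0 sin0; ring.
Qed.

End Polar.

Lemma enorm_polar {R : realType} {n : nat} (e w : 'rV[R]_n) (s t : R) :
  dot e e = 1 -> dot w w = 1 -> dot e w = 0 -> 0 <= s ->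
  enorm ((s * cos t) *: e + (s * sin t) *: w) = s.
Proof.
move=> ee ww ew s0; apply: enorm_eq => //.
rewrite !(dotDl, dotDr, dotZl, dotZr) ee ww (dotC w e) ew !mulr0 addr0 add0r.
by rewrite !mulr1 -!expr2 !exprMn -mulrDr cos2Dsin2 mulr1.
Qed.

Lemma is_derive_shiftZ {R : realType} (g : R -> R) (r xi t g' : R) :
  is_derive (r + xi * t) (1 : R) g g' ->
  is_derive t (1 : R) (fun s => g (r + xi * s)) (g' * xi).
Proof.
move=> dg.
have [D DE] := is_deriveD (is_derive_cst r t (1 : R))
  (is_deriveZ xi (is_derive_id t (1 : R))).
have dlin : is_derive t (1 : R) (fun s => r + xi * s) xi.
  by apply: DeriveDef D _; rewrite [LHS]DE -[_ *: _]/(_ * _) mulr1 add0r.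
exact: (@is_derive1_comp R g (fun s => r + xi * s) t g' xi dg dlin).
Qed.

Section RotationCurves.
Context {R : realType} {n : nat} (U : set 'rV[R]_n) (f : R -> R).
Hypotheses (oU : open U) (U_0 : U `<=` ~` [set 0]) (U_inv : O_invariant U).
Hypothesis f_gt0 : forall r, (@enorm R n @` U) r -> 0 < f r.
Hypothesis f_C2 : C2_on (@enorm R n @` U) f.

Local Notation I := (@enorm R n @` U).
Local Notation f1 := ('D_1 f).
Local Notation f2 := ('D_1 ('D_1 f)).

Variables (W : set (Cn R n)) (rho : Cn R n -> R).
Hypothesis rho_def : defining_function (D_minus U f) (Sigma_of U f) W rho.

Let oW : open W. Proof. by case: rho_def. Qed.
Let C2rho : C2_on W rho. Proof. by case: rho_def. Qed.
Let SW : Sigma_of U f `<=` W. Proof. by case: rho_def. Qed.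

Let rho_Sigma z : Sigma_of U f z -> rho z = 0.
Proof. by case: rho_def => _ _ _ [_ -> _] []. Qed.

Let rho_D z : W z -> D_minus U f z -> rho z < 0.
Proof.
move=> Wz Dz; case: rho_def => _ _ _ [WD _ _].
by have : (W `&` D_minus U f) z by []; rewrite WD => -[].
Qed.

Let U_enorm r x : I r -> enorm x = r -> U x.
Proof. by move=> [y Uy <-] xy; exact: U_inv Uy xy. Qed.

Let df r : I r -> is_derive r (1 : R) f (f1 r).
Proof.
move=> Ir; apply: derivableP; apply: diff_derivable.
by case: f_C2 => -[D _] _; exact: D.
Qed.

Let df1 r : I r -> is_derive r (1 : R) f1 (f2 r).
Proof.
move=> Ir; apply: derivableP; apply: diff_derivable.
by case: f_C2 => _ /(_ 1)[D _]; exact: D.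
Qed.

Variables (r : R) (e e' u u' : 'rV[R]_n).
Hypothesis Ir : I r.
Hypotheses (ee : dot e e = 1) (ee' : dot e e' = 0) (e'e' : dot e' e' = 1).
Hypotheses (uu : dot u u = 1) (uu' : dot u u' = 0) (u'u' : dot u' u' = 1).

Let p : Cn R n := (r *: e, f r *: u).

Let r0 : 0 < r. Proof. exact: (radii_gt0 U_0 Ir). Qed.
Let enorm_e : enorm e = 1. Proof. by apply: enorm_eq; rewrite ?expr1n. Qed.
Let enorm_u : enorm u = 1. Proof. by apply: enorm_eq; rewrite ?expr1n. Qed.

Lemma Sigma_of_point : Sigma_of U f p.
Proof.
have rE : enorm (r *: e) = r by rewrite enormZ ?enorm_e ?mulr1// ltW.
split; first exact: U_enorm Ir rE.
by rewrite /= rE enormZ ?enorm_u ?mulr1// ltW// f_gt0.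
Qed.

(** The curve is
    [x(t) = X (cos (alpha t) e + sin (alpha t) e')] and
    [y(t) = f(X) (cos (beta t) u + sin (beta t) u')] with [X = r + xi t]. By
    [O(n)]-invariance it stays in the hypersurface; [v] and [a] are its velocity
    and its acceleration at time 0. *)
Lemma rotation_curve (xi alpha beta : R) :
  let v : Cn R n := (xi *: e + (r * alpha) *: e',
                     (f1 r * xi) *: u + (f r * beta) *: u') in
  let a : Cn R n := (- (r * alpha ^+ 2) *: e + (2 * xi * alpha) *: e',
     (f2 r * xi ^+ 2 - f r * beta ^+ 2) *: u + (2 * (f1 r * xi) * beta) *: u') in
  'D_v rho p = 0 /\ hess rho p v v + 'D_a rho p = 0.
Proof.
move=> v a.
have near_I : \forall t \near (0 : R), I (r + xi * t).
  have cX : {for (0 : R), continuous (fun t : R => r + xi * t)}.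
    apply: continuousD; first exact: cst_continuous.
    by apply: continuousM; [exact: cst_continuous|].
  have nI : nbhs (r + xi * 0) I.
    rewrite mulr0 addr0; apply: open_nbhs_nbhs; split => //.
    exact: open_radii.
  exact: (cX _ nI).
pose X := fun t : R => r + xi * t.
have dX : \forall t \near (0 : R), is_derive t (1 : R) X xi.
  exists 1 => [|t _]; first exact: ltr01.
  have [D DE] := is_derive_shiftZ (is_derive_id (r + xi * t) (1 : R)).
  by apply: DeriveDef D _; rewrite [LHS]DE mul1r.
have dX1 : is_derive (0 : R) (1 : R) (fun _ => xi) 0 by exact: is_derive_cst.
pose F := fun t : R => f (r + xi * t).
pose F1 := fun t : R => f1 (r + xi * t) * xi.
have dF : \forall t \near (0 : R), is_derive t (1 : R) F (F1 t).
  by apply: filterS near_I => t It; exact/is_derive_shiftZ/df.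
have r_0 : r + xi * 0 = r by rewrite mulr0 addr0.
have dF1 : is_derive (0 : R) (1 : R) F1 (f2 r * xi ^+ 2).
  have Ir' : I (r + xi * 0) by rewrite r_0.
  have [D DE] := is_deriveM (is_derive_shiftZ (df1 Ir')) (is_derive_cst xi 0 (1 : R)).
  apply: DeriveDef D _; rewrite [LHS]DE -![_ *: _]/(_ * _) r_0 -[cst xi 0]/xi.
  by move: (f2 r) => m; rewrite mulr0 add0r; ring.
pose c (i : 'I_4) := nth (fun _ : R => 0 : R)
  [:: (fun t => X t * cos (alpha * t)); (fun t => X t * sin (alpha * t));
      (fun t => F t * cos (beta * t)); (fun t => F t * sin (beta * t))] i.
pose c1 (i : 'I_4) := nth (fun _ : R => 0 : R)
  [:: (fun t => xi * cos (alpha * t) + X t * (- alpha * sin (alpha * t)));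
      (fun t => xi * sin (alpha * t) + X t * (alpha * cos (alpha * t)));
      (fun t => F1 t * cos (beta * t) + F t * (- beta * sin (beta * t)));
      (fun t => F1 t * sin (beta * t) + F t * (beta * cos (beta * t)))] i.
pose c2 (i : 'I_4) := [:: 0 - X 0 * alpha ^+ 2; 2 * xi * alpha;
  f2 r * xi ^+ 2 - F 0 * beta ^+ 2; 2 * F1 0 * beta]`_i.
pose E (i : 'I_4) : Cn R n :=
  nth (0 : Cn R n) [:: (e, 0); (e', 0); (0, u); (0, u')] i.
have sumE (k : 'I_4 -> R) : \sum_i k i *: E i =
    (k ord0 *: e + k (lift ord0 ord0) *: e',
     k (lift ord0 (lift ord0 ord0)) *: u +
     k (lift ord0 (lift ord0 (lift ord0 ord0))) *: u') :> Cn R n.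
  rewrite !big_ord_recl big_ord0 /E /=.
  apply/pair_equal_spec; split => /=.
    by rewrite !scaler0 !addr0.
  by rewrite !scaler0 !addr0 !add0r.
have dc i : \forall t \near (0 : R), is_derive t (1 : R) (c i) (c1 i t).
  case: i => [[|[|[|[|//]]]] i4].
  - exact: is_derive_polar_cos dX.
  - exact: is_derive_polar_sin dX.
  - exact: is_derive_polar_cos dF.
  - exact: is_derive_polar_sin dF.
have dc1 i : is_derive (0 : R) (1 : R) (c1 i) (c2 i).
  case: i => [[|[|[|[|//]]]] i4].
  - exact: is_derive2_polar_cos dX dX1.
  - exact: is_derive2_polar_sin dX dX1.
  - exact: is_derive2_polar_cos dF dF1.
  - exact: is_derive2_polar_sin dF dF1.
have curve0 : curve c E 0 = p.
  by rewrite /curve sumE /c /= /X /F !mulr0 cos0 sin0 !mulr1 !mulr0 !scale0r !addr0.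
have on_Sigma : \forall t \near (0 : R), rho (curve c E t) = 0.
  apply: filterS near_I => t It; apply: rho_Sigma; rewrite /curve sumE /c /=.
  have X0 : 0 < X t := radii_gt0 U_0 It.
  have xE := enorm_polar (alpha * t) ee e'e' ee' (ltW X0).
  split; first exact: U_enorm It xE.
  by rewrite /= xE; apply: enorm_polar => //; apply/ltW/f_gt0.
have Wc : W (curve c E 0) by rewrite curve0; exact/SW/Sigma_of_point.
have := level_curve oW C2rho dc dc1 Wc on_Sigma.
rewrite curve0 !sumE /c1 /c2 /= /X /F /F1 r_0 !mulr0 cos0 sin0 !mulr1 !mulr0.
by rewrite !addr0 !add0r.
Qed.

(** Decreasing [|y|] leads into the domain, where [rho] is negative. *)
Lemma derive_outward_ge0 : 0 <= 'D_((0, u) : Cn R n) rho p.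
Proof.
have Sp := Sigma_of_point; have Wp := SW Sp.
have Dp : differentiable rho p by case: C2rho => -[D _] _; exact: D.
apply: derive_ge0_of_backward_le; first exact: diff_derivable.
have fr0 : 0 < f r := f_gt0 Ir.
have lineE (t : R) : t *: ((0, u) : Cn R n) + p = (r *: e, (t + f r) *: u) :> Cn R n.
  by apply/pair_equal_spec; split => /=; rewrite ?scaler0 ?add0r// scalerDl.
have cline : {for (0 : R), continuous (fun t : R => t *: ((0, u) : Cn R n) + p)}.
  apply: continuousD; first exact: scalel_continuous.
  exact: cst_continuous.
have nW : \forall t \near (0 : R), W (t *: ((0, u) : Cn R n) + p).
  have nW0 : nbhs (0 *: ((0, u) : Cn R n) + p) W.
    by rewrite scale0r add0r; exact: open_nbhs_nbhs.
  exact: (cline _ nW0).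
have npos : \forall t \near (0 : R), - f r < t.
  by apply: open_nbhs_nbhs; split; [exact: open_gt|rewrite /= oppr_lt0].
apply: filterS2 nW npos => t Wt ft t0; rewrite (rho_Sigma Sp) ltW//.
apply: rho_D Wt _; rewrite lineE; split; first exact: Sp.1.
have rE : enorm (r *: e) = r by rewrite enormZ ?enorm_e ?mulr1// ltW.
rewrite /= rE enormZ ?enorm_u ?mulr1; first by rewrite gtrDr.
by rewrite -lerBlDr sub0r ltW.
Qed.

End RotationCurves.

(** * Necessary conditions *)

Section Necessity.
Context {R : realType} {n : nat} (U : set 'rV[R]_n) (f : R -> R).
Hypotheses (n_gt1 : (1 < n)%N).
Hypotheses (oU : open U) (U_0 : U `<=` ~` [set 0]) (U_inv : O_invariant U).
Hypothesis f_gt0 : forall r, (@enorm R n @` U) r -> 0 < f r.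
Hypothesis f_C2 : C2_on (@enorm R n @` U) f.

Local Notation f1 := ('D_1 f).
Local Notation f2 := ('D_1 ('D_1 f)).

Definition of_real (w : Cn R n) : 'rV[R[i]]_n :=
  \row_j (w.1 ord0 j +i* w.2 ord0 j)%C.

Lemma of_realK w : real_of (of_real w) = w.
Proof.
by case: w => a b; apply/pair_equal_spec; split; apply/rowP => j; rewrite !mxE.
Qed.

Lemma derive_pair_comb (rho : Cn R n -> R) p (e e' u u' : 'rV[R]_n) (a b c d : R) :
  differentiable rho p ->
  'D_((a *: e + b *: e', c *: u + d *: u') : Cn R n) rho p =
  a * 'D_((e, 0) : Cn R n) rho p + b * 'D_((e', 0) : Cn R n) rho p +
  (c * 'D_((0, u) : Cn R n) rho p + d * 'D_((0, u') : Cn R n) rho p).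
Proof.
move=> D.
have -> : (a *: e + b *: e', c *: u + d *: u') =
    (a *: ((e, 0) : Cn R n) + b *: ((e', 0) : Cn R n)) +
    (c *: ((0, u) : Cn R n) + d *: ((0, u') : Cn R n)) :> Cn R n.
  apply/pair_equal_spec; split => /=.
    by rewrite !scaler0 !addr0.
  by rewrite !scaler0 !add0r.
by rewrite 3!(deriveD_dir _ _ D) 4!(deriveZ_dir _ _ D).
Qed.

(** The vectors [a] and [a'] are the accelerations of curves in the zero set with
    velocities [w] and [i w]. The sum of the two Hessian values is four times the
    Levi form, hence positive, and opposite to the sum on the left. *)
Lemma derive_acceleration_lt0 (W : set (Cn R n)) (rho : Cn R n -> R)
    (p w a a' : Cn R n) :
  open W -> C2_on W rho -> W p ->
  (forall v, complex_tangent rho p v -> v != 0 -> 0 < levi rho p v) ->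
  w != 0 ->
  'D_w rho p = 0 /\ hess rho p w w + 'D_a rho p = 0 ->
  'D_(mul_i w) rho p = 0 /\ hess rho p (mul_i w) (mul_i w) + 'D_a' rho p = 0 ->
  'D_a rho p + 'D_a' rho p < 0.
Proof.
move=> oW C2 Wp pos w0 [Dw hw] [Dw' hw'].
have D : differentiable rho p by case: C2 => -[D _] _; exact: D.
have tan : complex_tangent rho p (of_real w).
  by apply/(complex_tangentP _ D); rewrite of_realK.
have v0 : of_real w != 0.
  apply: contra w0 => /eqP v0; rewrite -[w]of_realK v0.
  by apply/eqP/pair_equal_spec; split; apply/rowP => j; rewrite !mxE.
have := pos _ tan v0; rewrite ltcE => /andP[_].
rewrite (Re_levi oW C2 Wp) of_realK.
move: (hess _ _ _ _) (hess _ _ _ _) hw hw' => h h' hw hw'.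
move: hw hw' => /eqP; rewrite addr_eq0 => /eqP-> /eqP; rewrite addr_eq0 => /eqP->.
by rewrite -opprD pmulr_lgt0 ?invr_gt0 ?ltr0n// oppr_gt0.
Qed.

Let pos_factor (P L k s : R) :
  0 <= P -> 0 < k -> s < 0 -> P * L = - (k * s) -> 0 < L.
Proof.
move=> P0 k0 s0 PL.
have PL0 : 0 < P * L by rewrite PL oppr_gt0 pmulr_rlt0.
have : 0 < P.
  by rewrite lt_def P0 andbT; apply: contraTneq PL0 => ->; rewrite mul0r ltxx.
by move=> Pgt0; rewrite -(pmulr_rgt0 _ Pgt0).
Qed.

(** Moving [|x|] alone gives [d rho (e, 0) = - f' d rho (0, u)]. So for
    each of the two pairs of curves the derivative of [rho] along the sum of the
    accelerations is [- P / f] times [levi_normal], respectively [levi_radial],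
    where [P = d rho (0, u) >= 0]. Since it is negative, that factor is positive. *)
Lemma levi_gt0_of_strongly_pseudoconvex_D_minus :
  strongly_pseudoconvex (D_minus U f) (Sigma_of U f) ->
  forall x, U x -> 0 < levi_normal f (enorm x) /\ 0 < levi_radial f (enorm x).
Proof.
move=> [W [rho [rho_def pos]]] x Ux; set r := enorm x.
have Ir : (@enorm R n @` U) r by exists x.
have x0 : x != 0 := base_neq0 U_0 Ux.
have r0 : 0 < r by rewrite enorm_gt0.
have fr0 : 0 < f r := f_gt0 Ir.
have [w [ww xw]] := exists_orthonormal n_gt1 x0.
pose e := r^-1 *: x.
have ee : dot e e = 1 by exact: dot_unit.
have ew : dot e w = 0 by rewrite dotZl xw mulr0.
have we : dot w e = 0 by rewrite dotC.
have oW : open W by case: rho_def.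
have C2 : C2_on W rho by case: rho_def.
have SW : Sigma_of U f `<=` W by case: rho_def.
have D1 q : Sigma_of U f q -> differentiable rho q.
  by case: C2 => -[D _] _ /SW/D.
have unit_neq0 (a : 'rV[R]_n) : dot a a = 1 -> a != 0.
  by move=> aa; rewrite -dot_eq0 aa oner_eq0.
have [rV fV] : r * r^-1 = 1 /\ f r * (f r)^-1 = 1.
  by rewrite !divff ?gt_eqF.
split.
  (* u = e and v = w: rotate x towards w for v, and y towards w for i v *)
- pose p : Cn R n := (r *: e, f r *: e).
  have Sp : Sigma_of U f p by exact: (Sigma_of_point U_0 U_inv f_gt0 Ir ee ee).
  have curves := rotation_curve oU U_0 U_inv f_gt0 f_C2 rho_def Ir ee ew ww ee ew ww.
  have out := derive_outward_ge0 U_0 U_inv f_gt0 rho_def Ir ee ee.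
  have [] := curves 0 r^-1 0.
  have -> : (0 *: e + (r * r^-1) *: w, (f1 r * 0) *: e + (f r * 0) *: w) =
      (w, 0) :> Cn R n.
    by rewrite rV !mulr0 !scale0r scale1r add0r addr0.
  move=> v1 h1; have [] := curves 0 0 (f r)^-1.
  have -> : (0 *: e + (r * 0) *: w, (f1 r * 0) *: e + (f r * (f r)^-1) *: w) =
      mul_i (w, 0) :> Cn R n.
    by rewrite fV !mulr0 !scale0r scale1r !add0r /mul_i /= oppr0.
  move=> v2 h2.
  have wN0 : ((w, 0) : Cn R n) != 0.
    by apply/eqP => /pair_equal_spec[/eqP]; rewrite (negbTE (unit_neq0 _ ww)).
  have := derive_acceleration_lt0 oW C2 (SW _ Sp) (fun v => pos p v Sp) wN0
    (conj v1 h1) (conj v2 h2).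
  have [grad0 _] := curves 1 0 0.
  move: grad0 out; rewrite !(derive_pair_comb _ _ _ _ _ _ _ _ (D1 _ Sp)).
  move: ('D_(e, 0) rho p) ('D_(w, 0) rho p) => Q Q'.
  move: ('D_(0, e) rho p) ('D_(0, w) rho p) => P P' grad0 P0 sum_lt0.
  apply: (pos_factor P0 fr0 sum_lt0); rewrite /levi_normal.
  have {grad0}-> : Q = - (f1 r * P).
    by apply/eqP; rewrite -addr_eq0 -[X in _ == X]grad0; apply/eqP; ring.
  move: (f r) (f1 r) (f2 r) fr0 => k k1 k2 k0.
  by field; rewrite !gt_eqF.
  (* u = w and v = e + i f' w: move |x| for v; for i v = - f' w + i e, rotate x
     towards - f' w and y towards e *)
- pose p : Cn R n := (r *: e, f r *: w).
  have Sp : Sigma_of U f p by exact: (Sigma_of_point U_0 U_inv f_gt0 Ir ee ww).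
  have curves := rotation_curve oU U_0 U_inv f_gt0 f_C2 rho_def Ir ee ew ww ww we ee.
  have out := derive_outward_ge0 U_0 U_inv f_gt0 rho_def Ir ee ww.
  have [] := curves 1 0 0.
  have -> : (1 *: e + (r * 0) *: w, (f1 r * 1) *: w + (f r * 0) *: e) =
      (e, f1 r *: w) :> Cn R n.
    by rewrite mulr1 !mulr0 !scale0r scale1r !addr0.
  move=> v1 h1; have [] := curves 0 (- (f1 r / r)) (f r)^-1.
  have -> : (0 *: e + (r * - (f1 r / r)) *: w,
             (f1 r * 0) *: w + (f r * (f r)^-1) *: e) =
      mul_i (e, f1 r *: w) :> Cn R n.
    by rewrite fV mulrN mulrCA rV mulr1 mulr0 !scale0r scale1r !add0r scaleNr.
  move=> v2 h2.
  have eN0 : ((e, f1 r *: w) : Cn R n) != 0.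
    by apply/eqP => /pair_equal_spec[/eqP]; rewrite (negbTE (unit_neq0 _ ee)).
  have := derive_acceleration_lt0 oW C2 (SW _ Sp) (fun v => pos p v Sp) eN0
    (conj v1 h1) (conj v2 h2).
  have [grad0 _] := curves 1 0 0.
  move: grad0 out; rewrite !(derive_pair_comb _ _ _ _ _ _ _ _ (D1 _ Sp)).
  move: ('D_(e, 0) rho p) ('D_(w, 0) rho p) => Q Q'.
  move: ('D_(0, e) rho p) ('D_(0, w) rho p) => P' P grad0 P0 sum_lt0.
  apply: (pos_factor P0 fr0 sum_lt0); rewrite /levi_radial.
  have {grad0}-> : Q = - (f1 r * P).
    by apply/eqP; rewrite -addr_eq0 -[X in _ == X]grad0; apply/eqP; ring.
  move: (f r) (f1 r) (f2 r) fr0 => k k1 k2 k0.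
  by field; rewrite !gt_eqF.
Qed.

End Necessity.

Theorem corollary2p2 (R : realType) (n : nat) (U : set 'rV[R]_n) (f : R -> R)
    (n_gt1 : (1 < n)%N) (U_open : open U) (U_neq0 : U !=set0)
    (U_0 : U `<=` ~` [set 0]) (U_inv : O_invariant U)
    (f_gt0 : forall r, (@enorm R n @` U) r -> 0 < f r)
    (f_C2 : C2_on (@enorm R n @` U) f) :
  let f' := derive1 f in
  let f'' := derive1 (derive1 f) in
  [/\ strongly_pseudoconvex (D_minus U f) (Sigma_of U f) <->
        (forall x, U x -> let r := enorm x in
          f r * f' r / r < 1 /\ f r * (f'' r + f' r ^+ 3 / r) < 1),
      (forall x, U x -> let r := enorm x in
          f r * f' r / r > 1 /\ f r * (f'' r + f' r ^+ 3 / r) > 1) ->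
        strongly_pseudoconvex (D_plus U f) (Sigma_of U f) &
      (forall x, U x -> let r := enorm x in
          f r * (f'' r + f' r ^+ 3 / r) = 1) ->
        ((forall x, U x -> let r := enorm x in f r * f' r / r < 1) ->
           weakly_pseudoconvex (D_minus U f) (Sigma_of U f)) /\
        ((forall x, U x -> let r := enorm x in f r * f' r / r > 1) ->
           weakly_pseudoconvex (D_plus U f) (Sigma_of U f))].
Proof.
move=> f' f''.
have f'E : f' = 'D_1 f by apply/funext => s; exact: derive1E.
have f''E : f'' = 'D_1 ('D_1 f).
  by rewrite /f'' -/f' f'E; apply/funext => s; exact: derive1E.
have one0 : (1 : R) != 0 by exact: oner_neq0.
have mone0 : (-1 : R) != 0 by rewrite oppr_eq0 oner_neq0.
have DmE := D_minus_tube_fun f_gt0; have DpE := D_plus_tube_fun f_gt0.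
rewrite f'E f''E; split; [split|..].
- move=> spc x Ux r.
  have [] := levi_gt0_of_strongly_pseudoconvex_D_minus
    n_gt1 U_open U_0 U_inv f_gt0 f_C2 spc Ux.
  rewrite levi_normal_gt0 levi_radial_gt0 => normal radial.
  exact: conj normal radial.
- move=> ineq; apply: (strongly_pseudoconvex_tube U_open U_0 f_gt0 f_C2 one0 DmE).
  move=> x Ux; rewrite !mul1r levi_normal_gt0 levi_radial_gt0.
  exact: ineq.
- move=> ineq; apply: (strongly_pseudoconvex_tube U_open U_0 f_gt0 f_C2 mone0 DpE).
  move=> x Ux; rewrite !mulN1r !oppr_gt0 levi_normal_lt0 levi_radial_lt0.
  exact: ineq.
- move=> ode; split=> ineq.
    apply: (weakly_pseudoconvex_tube U_open U_0 f_gt0 f_C2 one0 DmE) => x Ux.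
    rewrite (levi_radial_eq0 (ode x Ux)) mulr0 mul1r; split; last exact: lexx.
    by apply: ltW; rewrite levi_normal_gt0; exact: ineq.
  apply: (weakly_pseudoconvex_tube U_open U_0 f_gt0 f_C2 mone0 DpE) => x Ux.
  rewrite (levi_radial_eq0 (ode x Ux)) mulr0 mulN1r oppr_ge0.
  split; last exact: lexx.
  by apply: ltW; rewrite levi_normal_lt0; exact: ineq.
Qed.
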